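(* Let $\mathcal{A}$ be a (not necessarily acyclic) cluster algebra of geometric type of rank $n$, let $\mathcal{U}$ be its upper cluster algebra, and let $\Sigma$ be any seed of $\mathcal{A}$. Then $\tilde{x}_\Sigma[\mathbf{a}]\in\mathcal{U}$ for all $\mathbf{a}\in\mathbb{Z}^n$.
   Context: Seeds and mutation. Let $m\ge n\ge 1$ be integers, $\mathcal{F}=\mathbb{Q}(x_1,\dots,x_m)$, $[a]_+=\max(0,a)$. A seed of rank $n$ is a pair $\Sigma=(\tilde{\mathbf{x}},\tilde{B})$ where $\tilde{\mathbf{x}}=\{x_1,\dots,x_m\}$ is an $m$-tuple of elements of $\mathcal{F}$ forming a free generating set, and $\tilde{B}=(b_{ij})$ is an $m\times n$ integer matrix whose top $n\times n$ submatrix $B$ (the principal part) is sign-skew-symmetric: for all $i,j\le n$ either $b_{ij}=b_{ji}=0$ or $b_{ij},b_{ji}$ have opposite signs. For $1\le k\le n$, the mutation $\mu_k(\tilde{\mathbf{x}},\tilde{B})=(\tilde{\mathbf{x}}',\tilde{B}')$ is given by $x_i'=x_i$ for $i\ne k$, $x_k'=x_k^{-1}\big(\prod_{i=1}^m x_i^{[b_{ik}]_+}+\prod_{i=1}^m x_i^{[-b_{ik}]_+}\big)$, and $b_{ij}'=-b_{ij}$ if $i=k$ or $j=k$, $b'_{ij}=b_{ij}+\frac{|b_{ik}|b_{kj}+b_{ik}|b_{kj}|}{2}$ otherwise. It is well-defined if the principal part of $\tilde{B}'$ is again sign-skew-symmetric. A seed is totally mutable if every sequence of mutations from it consists of well-defined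 ones; two seeds are mutation-equivalent if related by a sequence of well-defined mutations. Cluster algebras. Put $\mathbb{ZP}=\mathbb{Z}[x_{n+1}^{\pm1},\dots,x_m^{\pm1}]$ (the variables $x_{n+1},\dots,x_m$ are never mutated). The cluster of a seed is $\mathbf{x}=\{x_1,\dots,x_n\}$. Given a totally mutable initial seed, the cluster algebra $\mathcal{A}$ of geometric type is the subring of $\mathcal{F}$ generated over $\mathbb{ZP}$ by all clusters of all seeds mutation-equivalent to the initial one; these seeds are the seeds of $\mathcal{A}$. The upper cluster algebra is $\mathcal{U}=\bigcap_{\mathbf{x}}\mathbb{ZP}[x_1^{\pm1},\dots,x_n^{\pm1}]$, where $\mathbf{x}=\{x_1,\dots,x_n\}$ runs over all clusters of $\mathcal{A}$. The elements $\tilde{x}_\Sigma[\mathbf{a}]$. Fix the seed $\Sigma=(\{x_1,\dots,x_m\},\tilde{B})$. Extend $\tilde B$ by $b_{ij}=-b_{ji}$ for $1\le i\le n<j\le m$ and $b_{ij}=0$ for $i,j>n$. Let $Q_{\tilde{B}}=\{(i,j): 1\le i,j\le m,\ b_{ij}>0\}$ and $Q_B=\{(i,j): 1\le i,j\le n,\ b_{ij}>0\}$. For finite $\{0,1\}$-sequences $t=(t_1,\dots,t_a)$, $t'=(t'_1,\dots,t'_b)$ put $\bar{t}=(1-t_1,\dots,1-t_a)$, $|t|=\sum_r t_r$, $t\cdot t'=\sum_{r=1}^{\min(a,b)}t_rt'_r$, and $\overline{()}=()$. For $\mathbf{a}=(a_1,\dots,a_n)\in\mathbb{Z}^n$ let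 $S_{\rm all}$ be the set of all $\mathbf{s}=(\mathbf{s}_1,\dots,\mathbf{s}_n)$ with $\mathbf{s}_i\in\{0,1\}^{[a_i]_+}$, and $S_{\rm gcc}=\{\mathbf{s}\in S_{\rm all}: \mathbf{s}_i\cdot\bar{\mathbf{s}}_j=0\text{ for every }(i,j)\in Q_B\}$. By convention $a_i=0$, $\mathbf{s}_i=()$ for $i>n$. Then $$\tilde{x}_\Sigma[\mathbf{a}]=\Big(\prod_{l=1}^n x_l^{-a_l}\Big)\sum_{\mathbf{s}\in S_{\rm gcc}}\ \prod_{(i,j)\in Q_{\tilde{B}}}x_i^{b_{ij}|\bar{\mathbf{s}}_j|}x_j^{-b_{ji}|\mathbf{s}_i|}.$$ *)

(* Defs.v *)
From HB Require Import structures.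
From mathcomp Require Import all_boot all_order all_algebra.
From mathcomp Require Import mpoly.

Set Implicit Arguments.
Unset Strict Implicit.
Unset Printing Implicit Defensive.

Import Order.TTheory GRing.Theory Num.Theory.
Local Open Scope ring_scope.

(* The number m >= n of variables is written m = n + p: the mutable indices   *)
(* are lshift p i with i : 'I_n, the frozen ones rshift n j with j : 'I_p.    *)

(* The field Q(x_1, ..., x_m). *)
Notation ratfun m := {fraction {mpoly rat[m]}}.

Definition pospart (a : int) : int := Num.max 0 a.

Inductive subring_gen (R : nzRingType) (G : R -> Prop) : R -> Prop :=
| subring_gen_in f : G f -> subring_gen G f
| subring_gen_1 : subring_gen G 1
| subring_gen_B f g : subring_gen G f -> subring_gen G g ->
    subring_gen G (f - g)
| subring_gen_M f g : subring_gen G f -> subring_gen G g ->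
    subring_gen G (f * g).

Definition subst (m : nat) (x : {ffun 'I_m -> ratfun m})
    (P : {mpoly rat[m]}) : ratfun m :=
  mmap (fun c : rat => FracField.tofrac c%:MP_[m]) x P.

Definition free_generating (m : nat) (x : {ffun 'I_m -> ratfun m}) : Prop :=
  (forall P : {mpoly rat[m]}, subst x P = 0 -> P = 0) /\
  (forall f : ratfun m, exists P Q : {mpoly rat[m]},
     subst x Q != 0 /\ f = subst x P / subst x Q).

(* Raw data of a seed; the conditions defining a seed are in is_seed. *)
Record seed (n p : nat) := Seed {
  svar : {ffun 'I_(n + p) -> ratfun (n + p)};
  smat : 'M[int]_(n + p, n)
}.

Definition sign_skew_symmetric (n : nat) (B : 'M[int]_n) : Prop :=
  forall i j : 'I_n, (B i j = 0 /\ B j i = 0) \/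
    (0 < B i j /\ B j i < 0) \/ (B i j < 0 /\ 0 < B j i).

Definition is_seed (n p : nat) (S : seed n p) : Prop :=
  free_generating (svar S) /\ sign_skew_symmetric (usubmx (smat S)).

Section Mutation.
Variables (n p : nat) (k : 'I_n) (S : seed n p).
Let x := svar S.
Let B := smat S.
Let k' : 'I_(n + p) := lshift p k.

Definition mutate_var : {ffun 'I_(n + p) -> ratfun (n + p)} :=
  [ffun i => if i == k' then
     (x k')^-1 * (\prod_(i < n + p) x i ^ pospart (B i k)
                  + \prod_(i < n + p) x i ^ pospart (- B i k))
   else x i].

(* The division by 2 is exact. *)
Definition mutate_mat : 'M[int]_(n + p, n) :=
  \matrix_(i, j) (if (i == k') || (j == k) then - B i j
    else B i j + divz (`|B i k| * B k' j + B i k * `|B k' j|) 2).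

Definition mutate : seed n p := Seed mutate_var mutate_mat.

Definition well_defined_mutation : Prop :=
  sign_skew_symmetric (usubmx (smat mutate)).

End Mutation.

Fixpoint mutable_along (n p : nat) (S : seed n p) (ks : seq 'I_n) : Prop :=
  if ks is k :: ks' then
    well_defined_mutation k S /\ mutable_along (mutate k S) ks'
  else True.

Definition mutate_seq (n p : nat) (S : seed n p) (ks : seq 'I_n) : seed n p :=
  foldl (fun T k => mutate k T) S ks.

Definition totally_mutable (n p : nat) (S : seed n p) : Prop :=
  forall ks : seq 'I_n, mutable_along S ks.

Definition mutation_equivalent (n p : nat) (S T : seed n p) : Prop :=
  exists ks : seq 'I_n, mutable_along S ks /\ T = mutate_seq S ks.

(* A cluster algebra comes with its seeds, hence is given by an initial seed; *)
(* the underlying subring of the ambient field is in_cluster_algebra.         *)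
Record cluster_algebra (n p : nat) := ClusterAlgebra {
  initial_seed : seed n p;
  initial_seedP : is_seed initial_seed;
  initial_seed_mutable : totally_mutable initial_seed
}.

Section ClusterAlgebra.
Variables (n p : nat) (A : cluster_algebra n p).

Definition seed_of (S : seed n p) : Prop :=
  mutation_equivalent (initial_seed A) S.

(* The frozen variables are the same in all the seeds of A. *)
Definition in_ZP : ratfun (n + p) -> Prop :=
  subring_gen (fun f => exists j : 'I_p,
    let y := svar (initial_seed A) (rshift n j) in f = y \/ f = y^-1).

Definition in_cluster_algebra : ratfun (n + p) -> Prop :=
  subring_gen (fun f => in_ZP f \/
    exists2 S, seed_of S & exists i : 'I_n, f = svar S (lshift p i)).

Definition in_laurent_ring (S : seed n p) : ratfun (n + p) -> Prop :=
  subring_gen (fun f => in_ZP f \/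
    exists i : 'I_n, let x := svar S (lshift p i) in f = x \/ f = x^-1).

Definition in_upper_cluster_algebra (f : ratfun (n + p)) : Prop :=
  forall S, seed_of S -> in_laurent_ring S f.

End ClusterAlgebra.

Definition bar (t : seq bool) : seq bool := map negb t.

Definition weight (t : seq bool) : nat := (\sum_(b <- t) b)%N.

Definition dot (t t' : seq bool) : nat :=
  (\sum_(r < minn (size t) (size t')) nth false t r * nth false t' r)%N.

Definition extend_mat (n p : nat) (B : 'M[int]_(n + p, n)) : 'M[int]_(n + p) :=
  block_mx (usubmx B) (- (dsubmx B)^T) (dsubmx B) 0.

Section Xtilde.
Variables (n p : nat) (S : seed n p) (a : 'I_n -> int).
Let x := svar S.
Let Bt := extend_mat (smat S).
Let B := usubmx (smat S).

Definition s_all := {dffun forall i : 'I_n, (`|pospart (a i)|%N).-tuple bool}.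

Definition s_gcc : {set s_all} :=
  [set s : s_all |
    [forall i, forall j, (0 < B i j) ==> (dot (s i) (bar (s j)) == 0%N)]].

Definition extend_s (s : s_all) (i : 'I_(n + p)) : seq bool :=
  match split i with inl i' => s i' | inr _ => [::] end.

Definition xtilde : ratfun (n + p) :=
  (\prod_(l < n) x (lshift p l) ^ (- a l)) *
  \sum_(s in s_gcc)
    \prod_(ij : 'I_(n + p) * 'I_(n + p) | 0 < Bt ij.1 ij.2)
      (x ij.1 ^ (Bt ij.1 ij.2 * (weight (bar (extend_s s ij.2)))%:Z)
       * x ij.2 ^ (- Bt ij.2 ij.1 * (weight (extend_s s ij.1))%:Z)).

End Xtilde.

(* Main.v *)
Require Import Defs.
From mathcomp Require Import all_boot all_order all_algebra.
From mathcomp Require Import mpoly.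
From HB Require Import structures.
From mathcomp Require Import ring zify.

Set Implicit Arguments.
Unset Strict Implicit.
Unset Printing Implicit Defensive.

Import Order.TTheory GRing.Theory Num.Theory.
Local Open Scope ring_scope.

(** Write L(T) for the ring of Laurent polynomials in the variables of a seed T,
    frozen ones included.  The element attached to S and to the vector a has to
    lie in L(T) for every seed T of the algebra, and three ideas give this.

    Factorization into slices.  The r-th letters of the sequences s_i interact
    only with one another, so the sum over all s splits into a product over r.
    Each factor is the sum for a 0/1 vector, that is, for a set D of mutable
    directions: the sum over the compatible t : D -> {0,1} of a product of head
    and tail monomials of the exchange relations, divided by the x_l with l in D
    (xtilde_slices).  Such a slice lies in L(S) by its shape.  It lies in
    L(mu_k S) because its numerator, up to terms divisible by x_k, is a
    multiple of the whole exchange binomial x_k x_k': if no other factor of a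
    term contains x_k, then both values of t_k are compatible and contribute
    head and tail of the exchange relation of k (slice_sum_divisible).

    Invariance of the upper bound.  If the columns of the exchange matrix are
    linearly independent, the intersection of L(S) with all the L(mu_k S) does
    not change under mutation, so that it is contained in every L(T).  This comes
    down to two distinct directions k and j (two_step): an element f of both
    L(mu_k S) and L(mu_j S) is in L(mu_j mu_k S) after multiplication by a power
    of x_j, and also after multiplication by a power of the product of x_k and
    mu_j(x_j).  In L(mu_j mu_k S), both x_k and mu_j(x_j) are coprime to x_j.  If
    b_jk is nonzero, this is a computation with the exchange relations, valid for
    any rank; if b_jk = 0, it says that two binomials with independent exponent
    vectors are coprime, and this is the only place where the rank enters.  Apart
    from a congruence in the first case, coprimality comes from a Gauss lemma in
    one variable (gauss).  It applies to every seed, because exchanging one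
    variable preserves algebraic independence (independent_exchange).

    Reduction to full rank.  For an arbitrary S, add n frozen variables whose
    rows in the exchange matrix form the identity matrix.  Setting the new
    variables to 1 specializes the extended seeds, their Laurent rings and the
    elements under study to the original ones.  Since a fraction has at most one
    specialization, membership in L(T) descends (extends_laurent,
    extends_xtilde). *)

(** * Subrings given by generators *)

Section GeneratedSubring.
Variables (F : fieldType) (G : F -> Prop).
Local Notation L := (subring_gen G).

Lemma gen0 : L 0.
Proof. by rewrite -(subrr 1); apply: subring_gen_B; apply: subring_gen_1. Qed.

Lemma genN f : L f -> L (- f).
Proof. by move=> Lf; rewrite -sub0r; apply: subring_gen_B => //; apply: gen0. Qed.

Lemma genD f g : L f -> L g -> L (f + g).
Proof. by move=> Lf Lg; rewrite -[g]opprK; apply/subring_gen_B/genN. Qed.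

Lemma genX f k : L f -> L (f ^+ k).
Proof.
move=> Lf; elim: k => [|k IH]; first exact: subring_gen_1.
by rewrite exprS; apply: subring_gen_M.
Qed.

Lemma gen_nat k : L k%:R.
Proof.
elim: k => [|k IH]; first exact: gen0.
by rewrite mulrS; apply: genD => //; apply: subring_gen_1.
Qed.

Lemma gen_sum (I : Type) (r : seq I) (P : pred I) (E : I -> F) :
  (forall i, P i -> L (E i)) -> L (\sum_(i <- r | P i) E i).
Proof. by move=> LE; elim/big_ind: _ => //; [apply: gen0 | apply: genD]. Qed.

Lemma gen_prod (I : Type) (r : seq I) (P : pred I) (E : I -> F) :
  (forall i, P i -> L (E i)) -> L (\prod_(i <- r | P i) E i).
Proof.
by move=> LE; elim/big_ind: _ => //; [exact: subring_gen_1 | exact: subring_gen_M].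
Qed.

Lemma gen_subset (G' : F -> Prop) f :
  (forall g, G g -> subring_gen G' g) -> L f -> subring_gen G' f.
Proof.
move=> GG'; elim=> [g /GG' //||g h _ IHg _ IHh|g h _ IHg _ IHh].
- exact: subring_gen_1.
- exact: subring_gen_B.
- exact: subring_gen_M.
Qed.

Definition gen_unit f := [/\ f != 0, L f & L f^-1].

Lemma gen_unit_in f : gen_unit f -> L f. Proof. by case. Qed.
Lemma gen_unit_inv f : gen_unit f -> L f^-1. Proof. by case. Qed.
Lemma gen_unit_neq0 f : gen_unit f -> f != 0. Proof. by case. Qed.

Lemma gen_unit1 : gen_unit 1.
Proof. by split; rewrite ?invr1 ?oner_neq0 //; apply: subring_gen_1. Qed.

Lemma gen_unitM f g : gen_unit f -> gen_unit g -> gen_unit (f * g).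
Proof.
case=> f0 Lf Lf' [g0 Lg Lg'].
by split; rewrite ?mulf_neq0 ?invfM //; apply: subring_gen_M.
Qed.

Lemma gen_unitV f : gen_unit f -> gen_unit f^-1.
Proof. by case=> f0 Lf Lf'; split; rewrite ?invr_eq0 ?invrK. Qed.

Lemma gen_unitN f : gen_unit f -> gen_unit (- f).
Proof. by case=> f0 Lf Lf'; split; rewrite ?oppr_eq0 ?invrN //; apply: genN. Qed.

Lemma gen_unitX f k : gen_unit f -> gen_unit (f ^+ k).
Proof.
move=> Uf; elim: k => [|k IH]; first exact: gen_unit1.
by rewrite exprS; apply: gen_unitM.
Qed.

Lemma gen_unitXz f (k : int) : gen_unit f -> gen_unit (f ^ k).
Proof.
by case: k => k Uf; [apply: gen_unitX | apply/gen_unitV/gen_unitX].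
Qed.

Lemma gen_unit_prod (I : Type) (r : seq I) (P : pred I) (E : I -> F) :
  (forall i, P i -> gen_unit (E i)) -> gen_unit (\prod_(i <- r | P i) E i).
Proof.
by move=> LE; elim/big_ind: _ => //; [apply: gen_unit1 | apply: gen_unitM].
Qed.

Lemma gen_unit_cancel f u : gen_unit u -> L (f * u) -> L f.
Proof. by case=> u0 _ Lu Lfu; rewrite -(mulfK u0 f); apply: subring_gen_M. Qed.

(** With g and h in L, this says that h is regular modulo g: a fraction whose
    denominator divides both g and h has no denominator.  Stated in this way,
    coprimality makes sense without reference to factorizations in L. *)
Definition gen_coprime g h := forall f, L (f * g) -> L (f * h) -> L f.

Lemma gen_coprime_sym g h : gen_coprime g h -> gen_coprime h g.
Proof. by move=> c f Lfh Lfg; apply: c. Qed.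

Lemma gen_coprimeMr g h k : L h ->
  gen_coprime g h -> gen_coprime g k -> gen_coprime g (h * k).
Proof.
move=> Lh gh gk f Lfg Lfhk; apply: gh => //; apply: gk; last by rewrite -mulrA.
by rewrite mulrAC; apply: subring_gen_M.
Qed.

Lemma gen_coprimeXr g h k : L h -> gen_coprime g h -> gen_coprime g (h ^+ k).
Proof.
move=> Lh gh; elim: k => [|k IH]; first by move=> f _; rewrite mulr1.
by rewrite exprS; apply: gen_coprimeMr.
Qed.

Lemma gen_coprimeX g h k l : L g -> L h ->
  gen_coprime g h -> gen_coprime (g ^+ k) (h ^+ l).
Proof.
move=> Lg Lh gh; apply/gen_coprimeXr => //.
by apply/gen_coprime_sym/gen_coprimeXr => //; apply/gen_coprime_sym.
Qed.

Lemma gen_coprime_unitM g h u v : gen_unit u -> gen_unit v ->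
  gen_coprime g h -> gen_coprime (u * g) (v * h).
Proof.
move=> Uu Uv gh f Lfg Lfh; apply: gh.
  by apply: (gen_unit_cancel Uu); rewrite -mulrA [g * u]mulrC.
by apply: (gen_unit_cancel Uv); rewrite -mulrA [h * v]mulrC.
Qed.

(** Turns membership in one Laurent ring into membership in another one up to
    the powers of a single e: it is enough that e clears the denominators of the
    generators. *)
Lemma gen_denominator (G' : F -> Prop) e f : L e ->
  (forall g, G' g -> exists k, L (g * e ^+ k)) -> subring_gen G' f ->
  exists k, L (f * e ^+ k).
Proof.
move=> Le G'd; elim=> [//||g h _ [k Lg] _ [l Lh]|g h _ [k Lg] _ [l Lh]].
- by exists 0; rewrite mulr1; apply: subring_gen_1.
- exists (k + l)%N; rewrite mulrBl; apply: subring_gen_B.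
    by rewrite exprD mulrA; apply/subring_gen_M/genX.
  by rewrite addnC exprD mulrA; apply/subring_gen_M/genX.
- exists (k + l)%N; rewrite exprD mulrACA; exact: subring_gen_M.
Qed.

End GeneratedSubring.

(** * A Gauss lemma in one variable *)

Section Gauss.
Variables (F : fieldType) (G : F -> Prop) (z : F).
Local Notation L0 := (subring_gen G).

Definition coefs_in (q : {poly F}) := forall d, L0 q`_d.

Definition transcendental := forall q, coefs_in q -> q.[z] = 0 -> q = 0.

Lemma coefs_inC c : L0 c -> coefs_in c%:P.
Proof. by move=> Lc d; rewrite coefC; case: eqP => // _; apply: gen0. Qed.

Lemma coefs_inX k : coefs_in 'X^k.
Proof. by move=> d; rewrite coefXn; case: eqP => // _; apply: gen_nat. Qed.

Lemma coefs_inB p q : coefs_in p -> coefs_in q -> coefs_in (p - q).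
Proof. by move=> Lp Lq d; rewrite coefB; apply: subring_gen_B. Qed.

Lemma coefs_inM p q : coefs_in p -> coefs_in q -> coefs_in (p * q).
Proof.
by move=> Lp Lq d; rewrite coefM; apply: gen_sum => i _; apply: subring_gen_M.
Qed.

Definition laurent_poly f := exists k, exists2 q, coefs_in q & f * z ^+ k = q.[z].

Lemma laurent_polyP f : z != 0 ->
  subring_gen (fun g => G g \/ (g = z \/ g = z^-1)) f <-> laurent_poly f.
Proof.
move=> z0; split.
  elim=> [g [Gg|[->|->]]||g h _ [k [p Lp Ep]] _ [l [q Lq Eq]]
         |g h _ [k [p Lp Ep]] _ [l [q Lq Eq]]].
  - exists 0; exists g%:P; rewrite ?hornerC ?mulr1 //.
    by apply/coefs_inC/subring_gen_in.
  - by exists 0; exists 'X; rewrite ?hornerX ?mulr1 //; apply: (coefs_inX 1).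
  - by exists 1; exists 1; rewrite ?hornerC ?mulVf //; apply: (coefs_inX 0).
  - by exists 0; exists 1; rewrite ?hornerC ?mulr1 //; apply: (coefs_inX 0).
  - exists (k + l)%N; exists (p * 'X^l - q * 'X^k).
      by apply: coefs_inB; apply: coefs_inM => //; apply: coefs_inX.
    by rewrite !(hornerE, hornerXn) -Ep -Eq exprD; ring.
  - exists (k + l)%N; exists (p * q); first exact: coefs_inM.
    by rewrite hornerM -Ep -Eq exprD; ring.
case=> k [q Lq E].
have -> : f = q.[z] * z^-1 ^+ k by rewrite -E exprVn mulfK // expf_neq0.
apply: subring_gen_M; last by apply/genX/subring_gen_in; right; right.
rewrite horner_coef; apply: gen_sum => d _; apply: subring_gen_M.
  by apply: gen_subset (Lq d) => g Gg; apply: subring_gen_in; left.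
by apply/genX/subring_gen_in; right; left.
Qed.

(** A polynomial whose leading coefficient is a unit is regular modulo any
    nonzero constant C.  Writing fC = q and f(a + bz^(k+1)) = r up to a power of
    z, one gets a q + b z^(k+1) q = C r, and comparing coefficients from the top
    down shows that C divides each coefficient of q. *)
Lemma gauss (C a b f : F) (k : nat) : transcendental -> z != 0 ->
  L0 C -> C != 0 -> L0 a -> gen_unit G b ->
  laurent_poly (f * C) -> laurent_poly (f * (a + b * z ^+ k.+1)) ->
  laurent_poly f.
Proof.
move=> tz z0 LC C0 La Ub [n1 [q1 Lq1 E1]] [n2 [r1 Lr1 E2]].
pose n := (n1 + n2)%N; pose q := q1 * 'X^n2; pose r := r1 * 'X^n1.
have Lq : coefs_in q by apply/coefs_inM/coefs_inX.
have Lr : coefs_in r by apply/coefs_inM/coefs_inX.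
have Eq : f * C * z ^+ n = q.[z] by rewrite hornerM hornerXn -E1 exprD mulrA.
have Er : f * (a + b * z ^+ k.+1) * z ^+ n = r.[z].
  by rewrite hornerM hornerXn -E2 /n addnC exprD mulrA.
clearbody q r.
have E : C%:P * r - (a%:P * q + b%:P * (q * 'X^(k.+1))) = 0.
  apply: tz.
    rewrite opprD addrA; apply: coefs_inB; first apply: coefs_inB.
    - by apply: coefs_inM => //; apply: coefs_inC.
    - by apply: coefs_inM => //; apply: coefs_inC.
    - apply: coefs_inM; first by apply: coefs_inC; case: Ub.
      by apply: coefs_inM => //; apply: coefs_inX.
  by rewrite !(hornerE, hornerXn) -Eq -Er /=; ring.
have Ed d : C * r`_(d + k.+1) = a * q`_(d + k.+1) + b * q`_d.
  move/eqP: E; rewrite subr_eq0 => /eqP/(congr1 (fun p : {poly F} => p`_(d + k.+1))).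
  by rewrite coefD !coefCM coefMXn ltnNge leq_addl /= addnK.
have Ld d : L0 (q`_d / C).
  move: {2}(size q - d)%N (leqnn (size q - d)%N) => m.
  elim: m d => [|m IH] d; rewrite leq_subLR.
    by rewrite addn0 => /(nth_default 0) ->; rewrite mul0r; apply: gen0.
  move=> le_s; have Ld : L0 (q`_(d + k.+1) / C) by apply: IH; lia.
  have -> : q`_d / C = (r`_(d + k.+1) - a * (q`_(d + k.+1) / C)) * b^-1.
    apply: (mulfI C0); apply: (mulfI (gen_unit_neq0 Ub)).
    transitivity (C * r`_(d + k.+1) - a * q`_(d + k.+1)).
      by rewrite Ed; field.
    by field; rewrite C0 (gen_unit_neq0 Ub).
  apply: subring_gen_M; last by case: Ub.
  by apply: subring_gen_B => //; apply: subring_gen_M.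
exists n; exists (C^-1 *: q); first by move=> d; rewrite coefZ mulrC.
by rewrite hornerZ -Eq; field.
Qed.

End Gauss.

(** * Algebraically independent families *)

Lemma mpoly_morph_ext (m : nat) (R : comNzRingType)
    (f g : {rmorphism {mpoly rat[m]} -> R}) :
  (forall c, f c%:MP = g c%:MP) -> (forall i, f 'X_i = g 'X_i) -> f =1 g.
Proof.
move=> fgC fgX p; rewrite [p]mpolyE !rmorph_sum; apply: eq_bigr => /= e _.
rewrite -mul_mpolyC !rmorphM /= fgC mpolyXE_id !rmorph_prod; congr (_ * _).
by apply: eq_bigr => i _; rewrite !rmorphXn /= fgX.
Qed.

Lemma exchange_step (F : fieldType) (c C P q X Y : F) : X != 0 ->
  (c * (C / X * P) + q) * (X * Y) = c * (C * P) * Y + q * Y * X.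
Proof. by move=> X0; field. Qed.

Lemma div_swap (F : fieldType) (a b c : F) : a = c / b -> a != 0 -> b = c / a.
Proof.
move=> -> ; rewrite mulf_eq0 negb_or invr_eq0 => /andP[c0 b0].
by field; rewrite c0 b0.
Qed.

Lemma div_neq0 (F : fieldType) (a b : F) : a != 0 -> b != 0 -> a / b != 0.
Proof. by move=> a0 b0; rewrite mulf_neq0 ?invr_eq0. Qed.

Section Substitution.
Variable m : nat.
Implicit Types (x y : {ffun 'I_m -> ratfun m}) (p q C : {mpoly rat[m]}) (i k : 'I_m).

Local Notation cst := (@FracField.tofrac _ \o @mpolyC m rat).

HB.instance Definition _ x :=
  GRing.RMorphism.copy (subst x) (mmap cst x).

Lemma substC x c : subst x c%:MP = cst c.
Proof. by rewrite -[LHS]/(mmap cst x _) mmapC. Qed.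

Lemma substX x i : subst x 'X_i = x i.
Proof. by rewrite -[LHS]/(mmap cst x _) mmapX mmap1U. Qed.

Lemma substXm x e : subst x 'X_[e] = \prod_i x i ^+ e i.
Proof. by rewrite -[LHS]/(mmap cst x _) mmapX. Qed.

Local Notation pcst := (@polyC _ \o @mpolyC m rat).
Local Notation pvar k :=
  (fun i : 'I_m => if i == k then 'X else ('X_i : {mpoly rat[m]})%:P).

(** A polynomial read as a polynomial in the k-th variable, whose coefficients
    stay in the ring of polynomials in all variables; this avoids reindexing the
    remaining variables. *)
Definition univar (k : 'I_m) : {mpoly rat[m]} -> {poly {mpoly rat[m]}} :=
  mmap pcst (pvar k).

HB.instance Definition _ k :=
  GRing.RMorphism.copy (univar k)
    (mmap pcst (pvar k)).

Definition free_of k p := univar k p = p%:P.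

Lemma univarX k i : univar k 'X_i = if i == k then 'X else ('X_i)%:P.
Proof. by rewrite -[LHS]/(mmap pcst (pvar k) _) mmapX mmap1U. Qed.

Lemma univarC k c : univar k c%:MP = (c%:MP)%:P.
Proof. by rewrite -[LHS]/(mmap pcst (pvar k) _) mmapC. Qed.

Lemma free_ofX k i : i != k -> free_of k 'X_i.
Proof. by rewrite /free_of univarX => /negbTE ->. Qed.

Lemma free_of1 k : free_of k 1.
Proof. by rewrite /free_of !rmorph1. Qed.

Lemma free_ofB k p q : free_of k p -> free_of k q -> free_of k (p - q).
Proof. by rewrite /free_of !rmorphB /= => -> ->. Qed.

Lemma free_ofD k p q : free_of k p -> free_of k q -> free_of k (p + q).
Proof. by rewrite /free_of !rmorphD /= => -> ->. Qed.

Lemma free_ofM k p q : free_of k p -> free_of k q -> free_of k (p * q).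
Proof. by rewrite /free_of !rmorphM /= => -> ->. Qed.

Lemma free_of_prodX k (e : 'I_m -> nat) : e k = 0 ->
  free_of k (\prod_i 'X_i ^+ e i).
Proof.
move=> ek0; rewrite /free_of !rmorph_prod /=; apply: eq_bigr => i _.
rewrite !rmorphXn /= univarX; case: eqP => // ->.
by rewrite ek0 !expr0.
Qed.

Lemma subst_univar k x y p : (forall i, i != k -> y i = x i) ->
  subst x p = (map_poly (subst y) (univar k p)).[x k].
Proof.
move=> yx.
pose g : {rmorphism _ -> _} := horner_eval (x k) \o map_poly (subst y) \o univar k.
rewrite -[RHS]/(g p); apply: mpoly_morph_ext => [c|i] /=.
  by rewrite /= univarC map_polyC /= /horner_eval hornerC !substC.
rewrite univarX substX; case: eqP => [->|/eqP ik].
  by rewrite map_polyX /horner_eval hornerX.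
by rewrite map_polyC /= /horner_eval hornerC substX yx.
Qed.

Lemma subst_free k x y p : (forall i, i != k -> y i = x i) -> free_of k p ->
  subst x p = subst y p.
Proof. by move=> yx fp; rewrite (subst_univar p yx) fp map_polyC hornerC. Qed.

Definition independent x := forall p, subst x p = 0 -> p = 0.

Lemma independent_neq0 x i : independent x -> x i != 0.
Proof.
move=> ix; apply/eqP => xi0; have := ix 'X_i.
rewrite substX => /(_ xi0)/(congr1 (mcoeff U_(i)%MM)) /eqP.
by rewrite mcoeffX eqxx mcoeff0 oner_eq0.
Qed.

Definition generic_point : {ffun 'I_m -> ratfun m} :=
  [ffun i => FracField.tofrac 'X_i].

Lemma subst_generic p : subst generic_point p = FracField.tofrac p.
Proof.
apply: mpoly_morph_ext => [c|i] /=; first by rewrite substC.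
by rewrite substX ffunE.
Qed.

Lemma independent_generic : independent generic_point.
Proof. by move=> p; rewrite subst_generic => /eqP; rewrite tofrac_eq0 => /eqP. Qed.

(** The numerator r is formal: it depends on p, k and C but not on the
    point x, which lets the proof of independent_exchange use it at two different
    points. *)
Lemma exchange_numerator k C p : exists N r, forall x y,
  x k != 0 -> (forall i, i != k -> y i = x i) -> y k = subst x C / x k ->
  subst y p * x k ^+ N = subst x r.
Proof.
elim/mpolyind: p => [|c e p _ _ [N [r IH]]].
  by exists 0, 0 => x y _ _ _; rewrite !rmorph0 mul0r.
exists (e k + N)%N.
exists (c%:MP * (C ^+ e k * \prod_(i | i != k) 'X_i ^+ e i) * 'X_k ^+ N
         + r * 'X_k ^+ e k) => x y xk yx yk.
rewrite -mul_mpolyC !(rmorphD, rmorphM, rmorphXn) /= substX substXm !substC.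
rewrite -(IH x y) // rmorph_prod (bigD1 k) //= yk expr_div_n.
rewrite (eq_bigr (fun i => subst x ('X_i ^+ e i))); last first.
  by move=> i ik; rewrite rmorphXn /= substX yx.
by rewrite exprD; apply: exchange_step; rewrite expf_neq0.
Qed.

(** Substituting C/X_k for X_k is an involution of the field of fractions, since
    C does not involve X_k.  A relation p between the new variables gives a
    numerator r that vanishes on the old ones, so r = 0.  At the point obtained
    from the generic one by the same exchange, r = 0 then says that p vanishes at
    the generic point. *)
Lemma independent_exchange k C x y : independent x -> free_of k C -> C != 0 ->
  (forall i, i != k -> y i = x i) -> y k = subst x C / x k -> independent y.
Proof.
move=> ix fC C0 yx yk p py0.
have [N [r Nr]] := exchange_numerator k C p.
have r0 : r = 0.
  have xk := independent_neq0 k ix.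
  by apply: ix; rewrite -(Nr x y xk yx yk) py0 mul0r.
pose X := generic_point.
pose X' : {ffun 'I_m -> ratfun m} :=
  [ffun i => if i == k then subst X C / X k else X i].
have X'X i : i != k -> X i = X' i by move=> /negbTE ik; rewrite [X' i]ffunE ik.
have Xk : X k != 0 by apply/independent_neq0/independent_generic.
have XC : subst X C != 0 by rewrite subst_generic tofrac_eq0.
have EX'k : X' k = subst X C / X k by rewrite ffunE eqxx.
have X'k : X' k != 0 by rewrite EX'k; exact: (div_neq0 XC Xk).
have EC : subst X' C = subst X C by apply: (@subst_free k).
have Ek : X k = subst X' C / X' k by rewrite EC; exact: div_swap.
have /eqP := Nr X' X X'k X'X Ek.
rewrite r0 rmorph0 mulf_eq0 expf_eq0 (negbTE X'k) andbF orbF subst_generic.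
by rewrite tofrac_eq0 => /eqP.
Qed.

End Substitution.

(** * Laurent polynomials in independent variables *)

Lemma pospart_ge0 a : 0 <= pospart a.
Proof. by rewrite /pospart le_max lexx. Qed.

Lemma pospart_id a : 0 <= a -> pospart a = a.
Proof. by rewrite /pospart => /max_r. Qed.

Lemma pospart_eq0 a : a <= 0 -> pospart a = 0.
Proof. by rewrite /pospart => /max_l. Qed.

Lemma pospartB a : pospart a - pospart (- a) = a.
Proof. by rewrite /pospart; lia. Qed.

Lemma pospartE b : pospart b = if 0 < b then b else 0.
Proof. by case: ltrP => [/ltW/pospart_id|/pospart_eq0]. Qed.

Section Laurent.
Variables (F : fieldType) (I : finType).
Implicit Types (x y z : I -> F) (v w : I -> int) (D : pred I).

Definition laurent_gen D x (f : F) : Prop := exists2 i, D i & f = x i \/ f = (x i)^-1.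

Definition laurent D x := subring_gen (laurent_gen D x).

Lemma laurent_unit D x i : D i -> x i != 0 -> gen_unit (laurent_gen D x) (x i).
Proof.
by move=> Di xi; split=> //; apply: subring_gen_in; exists i => //; [left|right].
Qed.

(** Exponents are functions with values in int, so that columns of an exchange
    matrix can be used directly. *)
Definition monomial x (v : I -> int) := \prod_i x i ^ v i.

Lemma monomialD x v w : (forall i, x i != 0) ->
  monomial x (fun i => v i + w i) = monomial x v * monomial x w.
Proof.
by move=> x0; rewrite -big_split; apply: eq_bigr => i _; rewrite expfzDr.
Qed.

Lemma monomialN x v : monomial x (fun i => - v i) = (monomial x v)^-1.
Proof.
by rewrite /monomial -prodfV; apply: eq_bigr => i _; rewrite invr_expz.
Qed.

Lemma monomialMn x v k :
  monomial x (fun i => v i * k) = monomial x v ^ k.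
Proof.
rewrite /monomial (big_morph (fun u => u ^ k) (fun a b => expfzMl a b k) (exp1rz _ k)).
by apply: eq_bigr => i _; rewrite exprz_exp.
Qed.

Lemma eq_monomial x y v w : (forall i, v i = 0 \/ x i = y i) -> v =1 w ->
  monomial x v = monomial y w.
Proof.
move=> xy vw; apply: eq_bigr => i _; rewrite -vw.
by case: (xy i) => ->; rewrite ?expr0z.
Qed.

Definition binomial_at z v :=
  monomial z (fun i => pospart (v i)) + monomial z (fun i => pospart (- v i)).

Lemma eq_binomial y z v w :
  (forall i, v i = 0 \/ y i = z i) -> v =1 w -> binomial_at y v = binomial_at z w.
Proof.
move=> yz vw; congr (_ + _); apply: eq_monomial => i; try by rewrite vw.
  by case: (yz i) => [v0|]; [left; rewrite v0 pospart_eq0 | right].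
by case: (yz i) => [v0|]; [left; rewrite v0 pospart_eq0 | right].
Qed.

Lemma binomial_opp z v : binomial_at z v = binomial_at z (fun i => - v i).
Proof.
rewrite /binomial_at addrC; congr (_ + _).
by apply: eq_monomial => i; [right | rewrite opprK].
Qed.

Lemma binomial_factor z v : (forall i, z i != 0) ->
  binomial_at z v = monomial z (fun i => pospart (- v i)) * (1 + monomial z v).
Proof.
move=> z0; rewrite mulrDr mulr1 -monomialD // addrC; congr (_ + _).
by apply: eq_monomial => [i|i]; [right | rewrite /pospart; lia].
Qed.

Lemma monomial_neq0 x v : (forall i, x i != 0) -> monomial x v != 0.
Proof. by move=> x0; apply/prodf_neq0 => i _; rewrite expfz_neq0. Qed.

Lemma monomial_unit D x v : (forall i, D i -> x i != 0) ->
  (forall i, ~~ D i -> v i = 0) -> gen_unit (laurent_gen D x) (monomial x v).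
Proof.
move=> x0 vD; apply: gen_unit_prod => i _; have [Di|nDi] := boolP (D i).
  by apply/gen_unitXz/laurent_unit => //; apply: x0.
by rewrite vD // expr0z; apply: gen_unit1.
Qed.

Lemma laurent_split x i f : laurent predT x f <->
  subring_gen (fun g => laurent_gen (predC1 i) x g \/ (g = x i \/ g = (x i)^-1)) f.
Proof.
split; apply: gen_subset => g.
  case=> j _ gj; apply: subring_gen_in; have [<-|ji] := eqVneq j i; first by right.
  by left; exists j.
by move=> [[j _ gj]|gi]; apply: subring_gen_in; [exists j|exists i].
Qed.

End Laurent.

Lemma fractionB (F : fieldType) (g h e e' p p' : F) : g * e = p -> h * e' = p' ->
  (g - h) * (e * e') = p * e' - p' * e.
Proof. by move=> <- <-; ring. Qed.

Lemma fractionM (F : fieldType) (g h e e' p p' : F) : g * e = p -> h * e' = p' ->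
  (g * h) * (e * e') = p * p'.
Proof. by move=> <- <-; ring. Qed.

Lemma scale_step (F : fieldType) (e e' c : F) (q : {poly F}) :
  e'%:P * (e *: q) * 'X + e%:P * (c * e')%:P = (e * e') *: (q * 'X + c%:P).
Proof. by rewrite -!mul_polyC !polyCM mulrDr; ring. Qed.

Section Independence.
Variables (m : nat) (x : {ffun 'I_m -> ratfun m}).
Hypothesis ix : independent x.

Let x0 i : x i != 0. Proof. exact: independent_neq0. Qed.

Lemma monomial_eq1 v : monomial x v = 1 -> forall i, v i = 0.
Proof.
pose e (w : 'I_m -> int) : 'X_{1..m} := [multinom `|pospart (w i)|%N | i < m].
have Ee w i : (e w i)%:Z = pospart (w i).
  by rewrite mnmE gez0_abs // /pospart le_max lexx.
have vE i : v i = (e v i)%:Z - (e (fun i => - v i) i)%:Z.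
  by rewrite !Ee /pospart; lia.
move=> v1 i.
have : e v = e (fun i => - v i).
  apply: contra_eq (oner_eq0 rat) => ne_e.
  have /ix/eqP : subst x ('X_[e v] - 'X_[e (fun i => - v i)]) = 0.
    rewrite rmorphB /= !substXm; apply/eqP; rewrite subr_eq0; apply/eqP.
    rewrite -[RHS](mul1r (\prod_i _)) -[X in X * _]v1 /monomial -big_split.
    apply: eq_bigr => j _ /=.
    by rewrite !exprnP -expfzDr ?x0 // [v j in RHS]vE subrK.
  move/eqP/(congr1 (mcoeff (e v))).
  by rewrite mcoeff0 mcoeffB !mcoeffX eqxx [_ == e v]eq_sym (negbTE ne_e) subr0 => /eqP.
by move=> E; rewrite vE -E subrr.
Qed.

(** The denominator e can be chosen to avoid x_i because f does. *)
Lemma laurent_fraction i f : laurent (predC1 i) x f ->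
  exists p e, [/\ free_of i p, free_of i e, e != 0 & f * subst x e = subst x p].
Proof.
elim=> [g [j ji]||g h _ [p [e [fp fe e0 E]]] _ [p' [e' [fp' fe' e0' E']]]
                |g h _ [p [e [fp fe e0 E]]] _ [p' [e' [fp' fe' e0' E']]]].
- case=> ->.
    exists 'X_j, 1; rewrite rmorph1 mulr1 substX oner_neq0.
    by split=> //; [apply: free_ofX | apply: free_of1].
  exists 1, 'X_j; rewrite rmorph1 substX mulVf //; split=> //.
  - exact: free_of1.
  - exact: free_ofX.
  - by apply: contraTneq (x0 j) => Xj; rewrite -substX Xj rmorph0 eqxx.
- by exists 1, 1; rewrite !rmorph1 mulr1 oner_neq0; split=> //; apply: free_of1.
- exists (p * e' - p' * e), (e * e'); rewrite mulf_neq0 //; split=> //.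
  + by apply: free_ofB; apply: free_ofM.
  + by apply: free_ofM.
  + by rewrite rmorphB !rmorphM /=; apply: fractionB.
- exists (p * p'), (e * e'); rewrite mulf_neq0 //; split=> //.
  + by apply: free_ofM.
  + by apply: free_ofM.
  + by rewrite !rmorphM /=; apply: fractionM.
Qed.

(** Denominators of the coefficients are cleared by one e free of x_i; what
    remains is a polynomial relation in x, whose coefficients with respect to
    X_i can be read off since none of them involves X_i. *)
Lemma transcendental_over i : transcendental (laurent_gen (predC1 i) x) (x i).
Proof.
move=> q Lq qx.
have [e [e0 fe [Q fQ EQ]]] : exists e, [/\ e != 0, free_of i e &
    exists2 Q : {poly {mpoly rat[m]}},
      (forall d, free_of i Q`_d) & map_poly (subst x) Q = subst x e *: q].
  elim/poly_ind: q Lq {qx} => [_|q c IH Lqc].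
    exists 1; split; [exact: oner_neq0 | exact: free_of1 |].
    exists 0; rewrite ?rmorph0 ?scaler0 //.
    by move=> d; rewrite coef0 /free_of !rmorph0.
  have [|e [e0 fe [Q fQ EQ]]] := IH.
    by move=> d; have := Lqc d.+1; rewrite coefD coefMX coefC addr0.
  have [|p [e' [fp fe' e'0 E]]] := @laurent_fraction i c.
    by have := Lqc 0; rewrite coefD coefMX coefC add0r.
  exists (e * e'); split; [exact: mulf_neq0 | exact: free_ofM |].
  exists (e'%:P * Q * 'X + (e * p)%:P).
    move=> d; rewrite coefD coefMX coefC; case: d => [|d] /=.
      by rewrite add0r; apply: free_ofM.
    by rewrite addr0 coefCM; apply: free_ofM.
  rewrite !(rmorphD, rmorphM) /= !map_polyC map_polyX /= EQ -E.
  exact: scale_step.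
have EQx : Q.['X_i] = 0.
  by apply: ix; rewrite -horner_map /= EQ substX hornerZ qx mulr0.
have Q0 : Q = 0.
  have <- : (map_poly (univar i) Q).['X] = Q.
    have -> : map_poly (univar i) Q = map_poly polyC Q.
      by apply/polyP => d; rewrite !coef_map /= fQ.
    exact: comp_polyXr.
  have := congr1 (univar i) EQx; rewrite -horner_map /= univarX eqxx => ->.
  exact: rmorph0.
apply/eqP; have /eqP := EQ; rewrite Q0 rmorph0 eq_sym scaler_eq0 => /orP[/eqP/ix|//].
by move/eqP; rewrite (negbTE e0).
Qed.

End Independence.

(** * Coprimality of binomials *)

(** 1 + X divides 1 - (- X)^k. *)
Lemma geometric_multiple (F : fieldType) (G : F -> Prop) f X k : subring_gen G X ->
  subring_gen G (f * (1 + X)) -> subring_gen G (f * (1 - (- X) ^+ k)).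
Proof.
move=> LX LfX.
have -> : f * (1 - (- X) ^+ k) = f * (1 + X) * \sum_(i < k) (- X) ^+ i.
  by rewrite -mulrA; congr (_ * _); rewrite -[LHS]opprB subrX1; ring.
by apply: subring_gen_M => //; apply: gen_sum => i _; apply/genX/genN.
Qed.

(** Eliminates Z between 1 - Za and 1 - Zb, as the resultant would. *)
Lemma resultant_step (F : fieldType) (G : F -> Prop) f Z a b :
  subring_gen G a -> subring_gen G b ->
  subring_gen G (f * (1 - Z * a)) -> subring_gen G (f * (1 - Z * b)) ->
  subring_gen G (f * (a - b)).
Proof.
move=> La Lb Lfa Lfb.
have -> : f * (a - b) = a * (f * (1 - Z * b)) - b * (f * (1 - Z * a)) by ring.
by apply: subring_gen_B; apply: subring_gen_M.
Qed.

Lemma sqr_exprN (R : comNzRingType) (a : R) k : ((- a) ^+ k) ^+ 2 = (a ^+ k) ^+ 2.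
Proof. by rewrite -!exprM ![(k * 2)%N]mulnC !exprM sqrrN. Qed.

Section Coprimality.
Variables (m : nat) (x : {ffun 'I_m -> ratfun m}).
Hypothesis ix : independent x.
Local Notation L := (laurent predT x).
Local Notation Lgen := (laurent_gen predT x).
Local Notation L0 i := (laurent (predC1 i) x).
Local Notation L0gen i := (laurent_gen (predC1 i) x).

Let x0 i : x i != 0. Proof. exact: independent_neq0. Qed.

Lemma laurent_sub i f : L0 i f -> L f.
Proof. by apply: gen_subset => g [j _ gj]; apply: subring_gen_in; exists j. Qed.

Lemma gen_unit_sub i f : gen_unit (L0gen i) f -> gen_unit Lgen f.
Proof. by case=> f0 Lf Lf'; split=> //; apply: (@laurent_sub i). Qed.

(** The form of gauss used below: C does not involve x_i, and the other factor
    has a unit as leading coefficient in x_i. *)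
Lemma gauss_coprime i C a b k : L0 i C -> C != 0 -> L0 i a -> gen_unit (L0gen i) b ->
  gen_coprime Lgen C (a + b * x i ^+ k.+1).
Proof.
move=> LC C0 La Ub f /laurent_split H1 /laurent_split H2; apply/laurent_split.
have polyP g := @laurent_polyP _ (L0gen i) (x i) g (x0 i).
apply/polyP; apply: (gauss (@transcendental_over _ _ ix i) (x0 i) LC C0 La Ub).
  exact: (proj1 (polyP _) (H1 i)).
exact: (proj1 (polyP _) (H2 i)).
Qed.

Definition cofactor_monomial i v := monomial x (fun j => if j == i then 0 else v j).

Lemma cofactor_unit i v : gen_unit (L0gen i) (cofactor_monomial i v).
Proof.
apply: monomial_unit => [j _|j /negbNE/eqP ->]; last by rewrite eqxx.
exact: x0.
Qed.

Lemma monomialE i v : monomial x v = x i ^ v i * cofactor_monomial i v.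
Proof.
rewrite /cofactor_monomial /monomial (bigD1 i) //=; congr (_ * _).
rewrite [RHS](bigD1 i) //= eqxx expr0z mul1r.
by apply: eq_bigr => j /negbTE ->.
Qed.

Lemma monomial_unitT v : gen_unit Lgen (monomial x v).
Proof. by apply: monomial_unit => // i _; apply: x0. Qed.

Lemma add1_monomial_neq0 w l : w l != 0 -> 1 + monomial x w != 0.
Proof.
apply: contraNneq => E; have : monomial x (fun i => w i * 2) = 1.
  have E' : monomial x w = -1 by apply/eqP; rewrite -addr_eq0 addrC E.
  by rewrite monomialMn E' -exprnP sqrrN expr1n.
by move/(monomial_eq1 ix)/(_ l)/eqP; rewrite mulf_eq0 orbF.
Qed.

Lemma coprime_monomial0 i v w k l : v i = k.+1%:Z -> w i = 0 -> w l != 0 ->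
  gen_coprime Lgen (1 + monomial x v) (1 + monomial x w).
Proof.
move=> vi wi wl; apply: gen_coprime_sym.
have Ew : monomial x w = cofactor_monomial i w.
  by rewrite (monomialE i) wi expr0z mul1r.
rewrite (monomialE i v) vi [_ ^ _ * _]mulrC; apply: gauss_coprime.
- apply: genD; first exact: subring_gen_1.
  by rewrite Ew; case: (cofactor_unit i w).
- exact: add1_monomial_neq0 wl.
- exact: subring_gen_1.
- exact: cofactor_unit.
Qed.

Definition lin_indep (v w : 'I_m -> int) :=
  forall a b : int, (forall l, a * v l + b * w l = 0) -> a = 0 /\ b = 0.

(** Both binomials involve x_i.  Suitable multiples 1 - x_i^N a and 1 - x_i^N b
    have the same degree N in x_i, and their resultant a - b is free of x_i; it
    is nonzero because the exponent vectors are independent.  The Gauss lemma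
    then applies to a - b and the first multiple. *)
Lemma coprime_monomialS i v w k l : v i = k.+1%:Z -> w i = l.+1%:Z ->
  lin_indep v w -> gen_coprime Lgen (1 + monomial x v) (1 + monomial x w).
Proof.
move=> vi wi vw f Lfv Lfw.
pose a := (- cofactor_monomial i v) ^+ l.+1.
pose b := (- cofactor_monomial i w) ^+ k.+1.
have Ua : gen_unit (L0gen i) a by apply/gen_unitX/gen_unitN/cofactor_unit.
have Ub : gen_unit (L0gen i) b by apply/gen_unitX/gen_unitN/cofactor_unit.
have Ev : (- monomial x v) ^+ l.+1 = x i ^+ (k.+1 * l.+1) * a.
  by rewrite (monomialE i) vi -exprnP -mulrN exprMn -exprM.
have Ew : (- monomial x w) ^+ k.+1 = x i ^+ (k.+1 * l.+1) * b.
  by rewrite (monomialE i) wi -exprnP -mulrN exprMn -exprM mulnC.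
clearbody a b.
have Lfa := geometric_multiple l.+1 (gen_unit_in (monomial_unitT v)) Lfv.
have Lfb := geometric_multiple k.+1 (gen_unit_in (monomial_unitT w)) Lfw.
rewrite Ev in Lfa; rewrite Ew in Lfb.
have La := gen_unit_in (gen_unit_sub Ua); have Lb := gen_unit_in (gen_unit_sub Ub).
have Lab := resultant_step La Lb Lfa Lfb.
have ab0 : a - b != 0.
  rewrite subr_eq0; apply/negP => /eqP Eab.
  (* The factor 2 removes the signs coming from the powers of - x^v and - x^w. *)
  have : monomial x (fun j => (v j * l.+1 + - (w j * k.+1)) * 2) = 1.
    rewrite monomialMn monomialD // monomialN !monomialMn -!exprnP.
    rewrite exprMn exprVn -sqr_exprN -[in X in _ / X]sqr_exprN Ev Ew Eab divff //.
    by apply/expf_neq0/mulf_neq0; [apply: expf_neq0 | apply: gen_unit_neq0 Ub].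
  move/(monomial_eq1 ix) => E; have [|] := vw l.+1%:Z (- k.+1%:Z); last by [].
  by move=> j; have := E j; lia.
move: Lfa; rewrite -mulrN [_ * - a]mulrC mulSn addSn => Lfa.
apply: (gauss_coprime _ ab0 _ _ Lab Lfa).
- by apply: subring_gen_B; [case: Ua | case: Ub].
- exact: subring_gen_1.
- exact: gen_unitN.
Qed.

Lemma coprime_monomialN v w :
  gen_coprime Lgen (1 + monomial x (fun i => - v i)) (1 + monomial x w) ->
  gen_coprime Lgen (1 + monomial x v) (1 + monomial x w).
Proof.
move=> H; rewrite -[X in gen_coprime _ _ X]mul1r.
have -> : 1 + monomial x v = monomial x v * (1 + monomial x (fun i => - v i)).
  rewrite monomialN mulrDr mulr1 divff; first exact: addrC.
  exact: monomial_neq0.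
by apply: gen_coprime_unitM => //; [apply: monomial_unitT | apply: gen_unit1].
Qed.

(** Some x_i occurs in x^v.  Inverting x^v or x^w only changes the binomials by
    units, so the exponents of x_i may be assumed nonnegative. *)
Lemma coprime_monomial v w : lin_indep v w ->
  gen_coprime Lgen (1 + monomial x v) (1 + monomial x w).
Proof.
move=> vw.
have [i vi] : exists i, v i != 0.
  apply/existsP; apply: contraPT vw; rewrite negb_exists => /forallP v0 vw.
  have [|//] := vw 1 0.
  by move=> l; rewrite (eqP (negbNE (v0 l))) mulr0 mul0r addr0.
have [l wl] : exists l, w l != 0.
  apply/existsP; apply: contraPT vw; rewrite negb_exists => /forallP w0 vw.
  have [|//] := vw 0 1.
  by move=> l; rewrite (eqP (negbNE (w0 l))) mulr0 mul0r addr0.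
wlog vi_gt0 : v vi vw / 0 < v i.
  move=> H; have [|vi_le0] := ltrP 0 (v i); first exact: H.
  apply/coprime_monomialN/H; rewrite ?oppr_eq0 ?oppr_gt0 ?lt_neqAle ?vi //.
  by move=> a b E; have [|a0 b0] := vw (- a) b => [j|]; [have := E j|]; lia.
have [k vk] : exists k, v i = k.+1%:Z by exists `|v i - 1|%N; lia.
have [wi0|wi] := eqVneq (w i) 0; first exact: coprime_monomial0 vk wi0 wl.
wlog wi_gt0 : w {wl} wi vw / 0 < w i.
  move=> H; have [|wi_le0] := ltrP 0 (w i); first exact: H.
  apply/gen_coprime_sym/coprime_monomialN/gen_coprime_sym/H.
  - by rewrite oppr_eq0.
  - by move=> a b E; have [|a0 b0] := vw a (- b) => [j|]; [have := E j|]; lia.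
  - by rewrite oppr_gt0 lt_neqAle wi.
have [j wj] : exists j, w i = j.+1%:Z by exists `|w i - 1|%N; lia.
exact: coprime_monomialS vk wj vw.
Qed.

End Coprimality.

(** * Seeds and their mutations *)

(** A formula for the mutated entry without division; it is the one that
    interacts well with linear algebra and with the positive parts in the exchange
    binomials. *)
Lemma mutation_termE (a b : int) :
  divz (`|a| * b + a * `|b|) 2 = pospart a * b + a * pospart (- b).
Proof.
have -> : `|a| * b + a * `|b| = (pospart a * b + a * pospart (- b)) * 2.
  case: (lerP 0 a) => a0; case: (lerP 0 b) => b0.
  - by rewrite !ger0_norm // pospart_id // (pospart_eq0 (a := - b)) ?oppr_le0 //; ring.
  - rewrite ger0_norm // ltr0_norm // pospart_id // pospart_id ?oppr_ge0 ?ltW //.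
    by ring.
  - rewrite ltr0_norm // ger0_norm // pospart_eq0 ?ltW //.
    by rewrite (pospart_eq0 (a := - b)) ?oppr_le0 //; ring.
  - rewrite !ltr0_norm // pospart_eq0 ?ltW // pospart_id ?oppr_ge0 ?ltW //.
    by ring.
by rewrite mulzK.
Qed.

Lemma mutation_term_involutive a b :
  pospart a * b + a * pospart (- b) + (pospart (- a) * - b + - a * pospart b) = 0.
Proof.
have := pospartB a; have := pospartB b.
by move: (pospart a) (pospart (- a)) (pospart b) (pospart (- b)) => ? ? ? ? <- <-; ring.
Qed.

Lemma mutation_term_opp a b :
  pospart (- a) * - b + - a * pospart b = - (pospart a * b + a * pospart (- b)).
Proof.
by apply/eqP; rewrite -addr_eq0 addrC mutation_term_involutive.
Qed.

Lemma seed_eq n p (S T : seed n p) : svar S = svar T -> smat S = smat T -> S = T.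
Proof. by case: S => x B; case: T => y C /= -> ->. Qed.

Lemma principalE n p (B : 'M[int]_(n + p, n)) i j :
  usubmx B i j = B (lshift p i) j.
Proof. by rewrite mxE. Qed.

Section Mutations.
Variables (n p : nat).
Implicit Types (S T : seed n p) (k j : 'I_n) (i : 'I_(n + p)).

Definition sskew S := sign_skew_symmetric (usubmx (smat S)).

Lemma sskew_diag S k : sskew S -> smat S (lshift p k) k = 0.
Proof. by move/(_ k k); rewrite !principalE; case=> [[]|[[]|[]]]; lia. Qed.

Lemma sskew_sign S j k : sskew S ->
  (smat S (lshift p j) k < 0) = (0 < smat S (lshift p k) j).
Proof. by move/(_ j k); rewrite !principalE => -[[]|[[]|[]]] *; try apply/idP/idP; lia. Qed.

Lemma sskew_eq0 S j k : sskew S ->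
  smat S (lshift p j) k = 0 -> smat S (lshift p k) j = 0.
Proof. by move/(_ j k); rewrite !principalE => -[[]|[[]|[]]] *; try apply/idP/idP; lia. Qed.

Definition exchange_binomial k S := binomial_at (svar S) (fun i => smat S i k).

Lemma mutate_var_same k S :
  svar (mutate k S) (lshift p k) = exchange_binomial k S / svar S (lshift p k).
Proof. by rewrite ffunE eqxx mulrC. Qed.

Lemma mutate_var_other k S i : i != lshift p k -> svar (mutate k S) i = svar S i.
Proof. by rewrite ffunE => /negbTE ->. Qed.

Lemma mutate_matE k S i j : smat (mutate k S) i j =
  if (i == lshift p k) || (j == k) then - smat S i j
  else smat S i j + (pospart (smat S i k) * smat S (lshift p k) j
                     + smat S i k * pospart (- smat S (lshift p k) j)).
Proof. by rewrite mxE mutation_termE. Qed.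

Lemma mutate_mat_row k S j : smat (mutate k S) (lshift p k) j = - smat S (lshift p k) j.
Proof. by rewrite mutate_matE eqxx. Qed.

Lemma mutate_mat_col k S i : smat (mutate k S) i k = - smat S i k.
Proof. by rewrite mutate_matE eqxx orbT. Qed.

(** The exchange binomial does not involve x_k, as the diagonal of a sign-skew-
    symmetric matrix vanishes, and it is nonzero since it takes the value 2 at
    the point all of whose coordinates are 1. *)
Lemma independent_mutate k S : sskew S -> independent (svar S) ->
  independent (svar (mutate k S)).
Proof.
move=> skS iS; pose e (f : 'I_(n + p) -> int) i := `|pospart (f i)|%N.
pose C : {mpoly rat[n + p]} :=
  \prod_i 'X_i ^+ e (fun i => smat S i k) i + \prod_i 'X_i ^+ e (fun i => - smat S i k) i.
have eE f i : e f i = pospart (f i) :> int by rewrite /e gez0_abs ?pospart_ge0.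
apply: (@independent_exchange _ (lshift p k) C (svar S)) => //.
- by apply: free_ofD; apply: free_of_prodX; rewrite /e sskew_diag.
- apply/eqP => C0; have : C.@[fun=> 1] = 0 by rewrite C0 meval0.
  rewrite mevalD !rmorph_prod /= !big1 => [|i _|i _] //;
    by rewrite rmorphXn /= mevalXU expr1n.
- by move=> i ik; rewrite mutate_var_other.
- rewrite mutate_var_same rmorphD /= !rmorph_prod; congr ((_ + _) / _);
    by apply: eq_bigr => i _; rewrite rmorphXn /= substX exprnP eE.
Qed.

Lemma mutateK k S : sskew S -> svar S (lshift p k) != 0 ->
  exchange_binomial k S != 0 -> mutate k (mutate k S) = S.
Proof.
move=> skS x0 P0; apply: seed_eq.
  apply/ffunP => i; have [->|ik] := eqVneq i (lshift p k); last first.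
    by rewrite !mutate_var_other.
  rewrite mutate_var_same.
  have -> : exchange_binomial k (mutate k S) = exchange_binomial k S.
    rewrite [RHS]binomial_opp; apply: eq_binomial => j; rewrite mutate_mat_col //.
    have [->|jk] := eqVneq j (lshift p k); last by right; rewrite mutate_var_other.
    by left; rewrite sskew_diag.
  by rewrite mutate_var_same invf_div mulrCA divff // mulr1.
apply/matrixP => i j; rewrite mutate_matE; case: ifP => [|/negbT].
  by rewrite mutate_matE => ->; rewrite opprK.
rewrite negb_or => /andP[ik jk]; rewrite mutate_mat_row mutate_mat_col.
rewrite mutate_matE (negbTE ik) (negbTE jk) /=.
by rewrite opprK -addrA mutation_term_involutive addr0.
Qed.

Definition full_rank S := forall c : 'I_n -> int,
  (forall i, \sum_j smat S i j * c j = 0) -> forall j, c j = 0.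

(** Mutation multiplies the matrix on both sides by invertible matrices.  The
    one on the right sends c to c', which differs from c only in the k-th entry. *)
Lemma full_rank_mutate k S : sskew S -> full_rank S -> full_rank (mutate k S).
Proof.
move=> skS fr c Bc.
pose r := \sum_(j | j != k) pospart (- smat S (lshift p k) j) * c j.
pose c' j := if j == k then r - c k else c j.
have Erow i : \sum_j smat S i j * c' j =
    \sum_(j | j != k) smat S i j * c j + smat S i k * (r - c k).
  rewrite (bigD1 k) //= addrC /c' eqxx; congr (_ + _).
  by apply: eq_bigr => j /negbTE ->.
have row_k : \sum_(j | j != k) smat S (lshift p k) j * c j = 0.
  have := Bc (lshift p k); rewrite (bigD1 k) //= mutate_mat_row sskew_diag // oppr0.
  rewrite mul0r add0r => /eqP; rewrite -oppr_eq0 -sumrN => /eqP E.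
  by rewrite -[RHS]E; apply: eq_bigr => j _; rewrite mutate_mat_row mulNr opprK.
have c'0 : forall j, c' j = 0.
  apply: fr => i; rewrite Erow; have [->|ik] := eqVneq i (lshift p k).
    by rewrite row_k sskew_diag // mul0r addr0.
  have := Bc i; rewrite (bigD1 k) //= mutate_mat_col.
  rewrite (eq_bigr (fun j => smat S i j * c j
      + (pospart (smat S i k) * (smat S (lshift p k) j * c j)
         + smat S i k * (pospart (- smat S (lshift p k) j) * c j)))); last first.
    by move=> j /negbTE jk; rewrite mutate_matE (negbTE ik) jk /=; ring.
  rewrite !big_split /= -!mulr_sumr row_k mulr0 add0r -/r => E; rewrite -[RHS]E; ring.
have cj j : j != k -> c j = 0 by move=> /negbTE jk; have := c'0 j; rewrite /c' jk.
have r0 : r = 0 by rewrite /r big1 // => j jk; rewrite cj // mulr0.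
move=> j; have [->|/cj //] := eqVneq j k; have := c'0 k.
by rewrite /c' eqxx r0; lia.
Qed.

Lemma full_rank_columns S j k : j != k -> full_rank S ->
  lin_indep (fun i => smat S i k) (fun i => smat S i j).
Proof.
move=> jk fr a b E; pose c l := if l == k then a else if l == j then b else 0.
have c0 : forall l, c l = 0.
  apply: fr => i; rewrite (bigD1 k) //= (bigD1 j) //= big1 => [|l /andP[lk lj]].
    by rewrite /c !eqxx (negbTE jk); have := E i; lia.
  by rewrite /c (negbTE lk) (negbTE lj) mulr0.
by have := c0 k; have := c0 j; rewrite /c !eqxx (negbTE jk).
Qed.

(** Changing the sign of the exchange matrix exchanges head and tail of every
    exchange relation, so it changes no variable; it allows choosing the sign of
    one entry. *)
Definition opp_seed S := Seed (svar S) (- smat S).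

Lemma mutate_opp k S : mutate k (opp_seed S) = opp_seed (mutate k S).
Proof.
apply: seed_eq.
  apply/ffunP => i; rewrite !ffunE /=; case: ifP => // _; congr (_ * _).
  by rewrite addrC; congr (_ + _); apply: eq_bigr => l _; rewrite !mxE ?opprK.
apply/matrixP => i j; rewrite mutate_matE [smat (opp_seed _)]/= !mxE mutation_termE.
case: ifP => // _.
by rewrite opprK mutation_term_opp -opprD.
Qed.

Lemma sskew_opp S : sskew S -> sskew (opp_seed S).
Proof.
move=> skS i j; have := skS i j; rewrite !principalE /= !mxE.
move: (smat S _ _) (smat S _ _) => a b; lia.
Qed.

End Mutations.

(** * Exchange relations in rank two *)

(** Three exchanges between two connected directions 1 and 2, with all other
    variables hidden in the monomials M1, N1, M2, N2.  The ring L stands for the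
    Laurent ring of the seed with variables x1' and z that is reached by mutating at 1 and then
    at 2: the exchanges are x1 x1' = x2^(b+1) M1 + N1, then x2 z = C, while
    x2' is obtained from x2 by mutating at 2 directly.  The relation EC is the
    mutation rule for the exponents of the second exchange. *)
Section RankTwoExchange.
Variables (F : fieldType) (G : F -> Prop).
Local Notation L := (subring_gen G).
Variables (x1 x1' x2 x2' z C M1 N1 M2 N2 u : F) (b c : nat).
Hypotheses (Ux1' : gen_unit G x1') (Uz : gen_unit G z) (UN1 : gen_unit G N1).
Hypotheses (LC : L C) (C0 : C != 0) (LM1 : L M1) (LM2 : L M2) (LN2 : L N2).
Hypotheses (Lu : L u).
Hypotheses (Ex2 : x2 = C / z) (Ex1 : x1 = (x2 ^+ b.+1 * M1 + N1) / x1').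
Hypotheses (Ex2' : x2' = (x1 ^+ c.+1 * M2 + N2) / x2).
Hypothesis EC : N2 * x1' ^+ c.+1 + M2 * N1 ^+ c.+1 = u * C.

Let LN1 : L N1. Proof. by case: UN1. Qed.
Let x1'0 : x1' != 0. Proof. by case: Ux1'. Qed.
Let z0 : z != 0. Proof. by case: Uz. Qed.
Let x20 : x2 != 0. Proof. by rewrite Ex2 mulf_neq0 ?invr_eq0. Qed.
Let P1 := x2 ^+ b.+1 * M1 + N1.

Lemma rank2_x2_in : L x2.
Proof. by rewrite Ex2; apply: subring_gen_M => //; case: Uz. Qed.

Let LP1 : L P1.
Proof. by apply: genD => //; apply: subring_gen_M => //; apply/genX/rank2_x2_in. Qed.

Lemma rank2_x1_in : L x1.
Proof. by rewrite Ex1; apply: subring_gen_M => //; case: Ux1'. Qed.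

(** This is M2 (P1^(c+1) - N1^(c+1)) / x2, where P1 = x1 x1'. *)
Let cross := M2 * (x2 ^+ b * M1) * \sum_(i < c.+1) P1 ^+ (c - i) * N1 ^+ i.

Let Lcross : L cross.
Proof.
apply: subring_gen_M.
  by do !apply: subring_gen_M => //; apply/genX/rank2_x2_in.
by apply: gen_sum => i _; apply: subring_gen_M; apply: genX.
Qed.

(** Obtained by expanding x1 x1' in powers of x2; since the right hand side
    lies in L and x1' is a unit, it proves the Laurent phenomenon for x2'. *)
Let x2'E : x2' * x1' ^+ c.+1 = u * z + cross.
Proof.
apply: (mulfI x20).
have -> : x2 * (x2' * x1' ^+ c.+1) = P1 ^+ c.+1 * M2 + N2 * x1' ^+ c.+1.
  have -> : P1 = x1 * x1' by rewrite Ex1 divfK.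
  by rewrite Ex2' exprMn; field.
have -> : N2 * x1' ^+ c.+1 = u * C - M2 * N1 ^+ c.+1 by rewrite -EC addrK.
have -> : u * C = x2 * (u * z) by rewrite Ex2; field.
have -> : P1 ^+ c.+1 * M2 + (x2 * (u * z) - M2 * N1 ^+ c.+1)
    = M2 * (P1 ^+ c.+1 - N1 ^+ c.+1) + x2 * (u * z) by ring.
have -> : P1 ^+ c.+1 - N1 ^+ c.+1
    = (P1 - N1) * \sum_(i < c.+1) P1 ^+ (c - i) * N1 ^+ i by exact: subrXX.
have -> : P1 - N1 = x2 * (x2 ^+ b * M1) by rewrite /P1 exprS; ring.
by rewrite /cross; ring.
Qed.

Lemma rank2_x2'_in : L x2'.
Proof.
apply: (gen_unit_cancel (gen_unitX c.+1 Ux1')); rewrite x2'E.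
by apply: genD => //; apply: subring_gen_M => //; case: Uz.
Qed.

(** Modulo x2, the product x1 x1' is the unit N1. *)
Lemma rank2_coprime_x2_x1 : gen_coprime G x2 x1.
Proof.
move=> f Lf2 Lf1; apply: (gen_unit_cancel UN1).
have -> : f * N1 = f * x1 * x1' - f * x2 * (x2 ^+ b * M1).
  have -> : f * x1 * x1' = f * P1 by rewrite Ex1 -mulrA divfK.
  by rewrite /P1 exprS; ring.
apply: subring_gen_B; apply: subring_gen_M => //; first by case: Ux1'.
by apply: subring_gen_M => //; apply/genX/rank2_x2_in.
Qed.

(** The value of cross at x2 = 0, with 0^0 = 1: it vanishes unless the exponent of x2
    in the first relation is 1. *)
Definition rank2_constant := M2 * (0 ^+ b * M1) * (N1 ^+ c *+ c.+1).

Let L_powersB X Y k : L X -> L Y -> L (\sum_(i < k) X ^+ (k.-1 - i) * Y ^+ i).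
Proof.
by move=> LX LY; apply: gen_sum => i _; apply: subring_gen_M; apply: genX.
Qed.

(** P1 is congruent to N1 and x2^b to 0^b modulo x2. *)
Let cross_mod f : L (f * x2) -> L (f * (cross - rank2_constant)).
Proof.
move=> Lf; have Lf' h : L h -> L (f * (x2 * h)) by rewrite mulrA; apply: subring_gen_M.
have Lx := rank2_x2_in; have L0 := gen0 G.
have -> : cross - rank2_constant =
    x2 * (M2 * M1 * (\sum_(i < b) x2 ^+ (b.-1 - i) * 0 ^+ i)
          * \sum_(i < c.+1) P1 ^+ (c - i) * N1 ^+ i)
    + x2 * (M2 * (0 ^+ b * M1) * \sum_(i < c.+1) (x2 ^+ b * M1
        * \sum_(j < c - i) P1 ^+ ((c - i).-1 - j) * N1 ^+ j) * N1 ^+ i).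
  have -> : \sum_(i < c.+1) (x2 ^+ b * M1
        * \sum_(j < c - i) P1 ^+ ((c - i).-1 - j) * N1 ^+ j) * N1 ^+ i
    = \sum_(i < c.+1) x2^-1 * (P1 ^+ (c - i) * N1 ^+ i - N1 ^+ c).
    apply: eq_bigr => i _.
    have -> : N1 ^+ c = N1 ^+ (c - i) * N1 ^+ i.
      by rewrite -exprD subnK // -ltnS.
    rewrite -mulrBl subrXX.
    have -> : P1 - N1 = x2 * (x2 ^+ b * M1) by rewrite /P1 exprS; ring.
    by rewrite -!mulrA mulKf.
  rewrite -mulr_sumr sumrB sumr_const card_ord.
  have := subrXX x2 0 b; rewrite subr0 => Eb.
  have {Eb} -> : \sum_(i < b) x2 ^+ (b.-1 - i) * 0 ^+ i = x2^-1 * (x2 ^+ b - 0 ^+ b).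
    by rewrite Eb mulKf.
  rewrite /cross /rank2_constant.
  by move: (\sum_(i < _) _) (N1 ^+ c *+ c.+1) => A B; field.
rewrite mulrDr; apply: genD; apply: Lf'.
  by do !apply: subring_gen_M => //; apply: L_powersB.
apply: subring_gen_M; first by do !apply: subring_gen_M => //; apply: genX.
apply: gen_sum => i _; do !apply: subring_gen_M; rewrite //; try exact: genX.
exact: L_powersB.
Qed.

(** x2 is C up to a unit, and modulo x2 a unit multiple of x2' is a linear
    polynomial in z.  When C and both coefficients do not involve z, the
    hypothesis is an instance of the Gauss lemma in z. *)
Lemma rank2_coprime_x2_x2' :
  gen_coprime G C (rank2_constant + u * z) -> gen_coprime G x2 x2'.
Proof.
move=> cop f Lf2 Lf2'; apply: cop.
  have -> : f * C = f * x2 * z by rewrite Ex2; field.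
  by apply: subring_gen_M => //; case: Uz.
have -> : f * (rank2_constant + u * z)
    = f * x2' * x1' ^+ c.+1 - f * (cross - rank2_constant).
  by rewrite -mulrA x2'E; ring.
apply: subring_gen_B; last exact: cross_mod.
by apply: subring_gen_M => //; apply: genX; case: Ux1'.
Qed.

End RankTwoExchange.

(** * Two mutations in a row *)

Section TwoStep.
Variables (n p : nat).
Implicit Types (S : seed n p) (j k : 'I_n).
Local Notation ix := (lshift p).

Lemma laurent_clear (F : fieldType) (I : finType) (G : F -> Prop) (y : I -> F) e f :
  subring_gen G e ->
  (forall i, subring_gen G (y i) /\ subring_gen G ((y i)^-1 * e)) ->
  laurent predT y f -> exists N, subring_gen G (f * e ^+ N).
Proof.
move=> Le H; apply: gen_denominator => // g [i _ [->|->]]; exists 1; case: (H i) => //.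
by move=> Ly _; apply: subring_gen_M.
Qed.

Definition in_laurent S := laurent predT (svar S).

Lemma gen_unit_svar S i : independent (svar S) ->
  gen_unit (laurent_gen predT (svar S)) (svar S i).
Proof. by move=> iS; apply: laurent_unit => //; apply: independent_neq0. Qed.

(** The variables of mu_k S are those of mu_j mu_k S except x_j, and those of
    mu_j S are except x_k and mu_j(x_j); hence f acquires a denominator that is a
    power of x_j, and another that is a power of the product of the other two. *)
Lemma two_step_of_coprime S j k f (L := in_laurent (mutate j (mutate k S)))
    (cop := gen_coprime (laurent_gen predT (svar (mutate j (mutate k S)))))
    (x1 := svar S (ix k)) (x2 := svar S (ix j))
    (x2' := svar (mutate j S) (ix j)) :
  j != k ->
  independent (svar S) -> independent (svar (mutate j S)) ->
  independent (svar (mutate j (mutate k S))) ->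
  L x1 -> L x2 -> L x2' -> cop x2 x1 -> cop x2 x2' ->
  in_laurent (mutate k S) f -> in_laurent (mutate j S) f -> L f.
Proof.
move=> jk iS iS2 iy Lx1 Lx2 Lx2' cop1 cop2 Lf1 Lf2.
have jk' : ix k != ix j :> 'I_(n + p) by rewrite eq_sym (inj_eq (@lshift_inj _ _)).
have Uy i := gen_unit_svar i iy.
have [a La] : exists a, L (f * x2 ^+ a).
  apply: (laurent_clear Lx2 _ Lf1) => i; have [->|ij] := eqVneq i (ix j).
    rewrite mutate_var_other 1?eq_sym // mulVf ?independent_neq0 //.
    by split=> //; apply: subring_gen_1.
  rewrite -(@mutate_var_other _ _ j) //; case: (Uy i) => _ Ly Ly'.
  by split=> //; apply: subring_gen_M.
have [b Lb] : exists b, L (f * (x1 * x2') ^+ b).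
  apply: (laurent_clear _ _ Lf2) => [|i]; first exact: subring_gen_M.
  have [->|ij] := eqVneq i (ix j).
    by rewrite mulrCA mulVf ?mulr1 ?independent_neq0.
  rewrite mutate_var_other //; have [->|ik] := eqVneq i (ix k).
    by rewrite mulKf ?independent_neq0.
  rewrite -(@mutate_var_other _ _ k S i) // -(@mutate_var_other _ _ j) //.
  case: (Uy i) => _ Ly Ly'.
  by split=> //; apply: subring_gen_M => //; apply: subring_gen_M.
have cop12 : cop x2 (x1 * x2') by apply: gen_coprimeMr.
exact: (gen_coprimeX Lx2 (subring_gen_M Lx1 Lx2') cop12 La Lb).
Qed.

Lemma numerator_neq0 (F : fieldType) (a b c : F) : a = c / b -> a != 0 -> c != 0.
Proof. by move=> ->; rewrite mulf_eq0 negb_or => /andP[]. Qed.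

Lemma unit_factor (F : fieldType) (a b c u q : F) : a = c / b -> c = u * q ->
  a = b^-1 * u * q.
Proof. by move=> -> ->; ring. Qed.

Lemma rank2_unit_relation (F : fieldType) (X Y N2 W1 W2 : F) : W1 != 0 ->
  Y * W1 = N2 * W2 -> N2 * X + Y = N2 / W1 * (X * W1 + W2).
Proof. by move=> W0 E; apply: (mulIf W0); rewrite mulrDl E; field. Qed.

Section Pair.
Variables (S : seed n p) (j k : 'I_n).
Hypotheses (jk : j != k) (skS : sskew S).
Hypotheses (iS : independent (svar S)) (iT : independent (svar (mutate j (mutate k S)))).
Local Notation T := (mutate j (mutate k S)).
Local Notation B := (smat S).
Local Notation y := (svar T).
Local Notation Tgen := (laurent_gen predT y).

Let kj' : ix k != ix j :> 'I_(n + p).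
Proof. by rewrite eq_sym (inj_eq (@lshift_inj _ _)). Qed.
Let jk' : ix j != ix k :> 'I_(n + p). Proof. by rewrite eq_sym. Qed.

Lemma two_step_other i : i != ix k -> i != ix j -> y i = svar S i.
Proof. by move=> ik ij; rewrite !mutate_var_other. Qed.

Lemma two_step_x1 : svar S (ix k) = binomial_at (svar S) (fun i => B i k) / y (ix k).
Proof.
apply: div_swap; last exact: independent_neq0.
by rewrite mutate_var_other // mutate_var_same.
Qed.

Lemma two_step_x2 : svar S (ix j)
  = binomial_at (svar (mutate k S)) (fun i => smat (mutate k S) i j) / y (ix j).
Proof.
rewrite -(mutate_var_other S jk'); apply: div_swap; last exact: independent_neq0.
by rewrite mutate_var_same.
Qed.

Lemma two_step_x2' : svar (mutate j S) (ix j)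
  = binomial_at (svar S) (fun i => B i j) / svar S (ix j).
Proof. by rewrite mutate_var_same. Qed.

Hypothesis iS2 : independent (svar (mutate j S)).

(** Here the mutations at j and k commute, x_k and x_j are the exchange binomials of
    k and j up to units, and mu_j(x_j) is a variable of the last seed. *)
Lemma two_step_commuting f : B (ix j) k = 0 ->
  lin_indep (fun i => B i k) (fun i => B i j) ->
  in_laurent (mutate k S) f -> in_laurent (mutate j S) f -> in_laurent T f.
Proof.
move=> Bjk li; have Bkj := sskew_eq0 skS Bjk.
have y0 i : y i != 0 by apply: independent_neq0.
have Bkk := sskew_diag k skS; have Bjj := sskew_diag j skS.
have Sy v : v (ix k) = 0 -> v (ix j) = 0 -> binomial_at (svar S) v = binomial_at y v.
  move=> vk vj; apply: eq_binomial => // i.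
  have [->|ik] := eqVneq i (ix k); first by left.
  have [->|ij] := eqVneq i (ix j); first by left.
  by right; rewrite two_step_other.
have Ek : binomial_at (svar S) (fun i => B i k) = binomial_at y (fun i => B i k).
  exact: Sy.
have Ej : binomial_at (svar S) (fun i => B i j) = binomial_at y (fun i => B i j).
  exact: Sy.
have Ej' : binomial_at (svar (mutate k S)) (fun i => smat (mutate k S) i j)
    = binomial_at y (fun i => B i j).
  rewrite -Ej; apply: eq_binomial => i.
    have [->|ik] := eqVneq i (ix k); first by left; rewrite mutate_mat_row Bkj.
    by right; rewrite mutate_var_other.
  rewrite mutate_matE (negbTE jk) orbF; case: eqP => [->|_]; first by rewrite Bkj.
  by rewrite Bkj /pospart oppr0 maxxx !mulr0 !addr0.
pose U v := monomial y (fun i => pospart (- v i)).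
have UU v : gen_unit Tgen (U v) by apply: monomial_unit.
have x1E : svar S (ix k)
    = (y (ix k))^-1 * U (fun i => B i k) * (1 + monomial y (fun i => B i k)).
  by apply: (unit_factor two_step_x1); rewrite Ek; apply: binomial_factor.
have x2E : svar S (ix j)
    = (y (ix j))^-1 * U (fun i => B i j) * (1 + monomial y (fun i => B i j)).
  by apply: (unit_factor two_step_x2); rewrite Ej'; apply: binomial_factor.
have x2'E : svar (mutate j S) (ix j) = y (ix j).
  rewrite two_step_x2' Ej -Ej' mutate_var_same; congr (_ / _).
  by rewrite mutate_var_other.
have Uy i : gen_unit Tgen (y i) by apply: gen_unit_svar.
have UL v : gen_unit Tgen (monomial y v) by apply: monomial_unit.
have U1 i v : gen_unit Tgen ((y i)^-1 * U v) by apply/gen_unitM/UU/gen_unitV.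
have L1 v : in_laurent T (1 + monomial y v).
  by apply: genD; [apply: subring_gen_1 | case: (UL v)].
apply: (two_step_of_coprime jk iS iS2 iT).
- by rewrite x1E; exact: (subring_gen_M (gen_unit_in (U1 _ _)) (L1 _)).
- by rewrite x2E; exact: (subring_gen_M (gen_unit_in (U1 _ _)) (L1 _)).
- by rewrite x2'E; exact: (gen_unit_in (Uy _)).
- rewrite x1E x2E; apply: (gen_coprime_unitM (U1 _ _) (U1 _ _)).
  exact/gen_coprime_sym/coprime_monomial.
- by rewrite x2'E => g _; apply: (gen_unit_cancel (Uy _)).
Qed.

(** The part of an exponent vector that concerns the variables shared by the
    four seeds around S, mu_k S, mu_j S and mu_j mu_k S. *)
Definition away v : 'I_(n + p) -> int :=
  fun i => if (i == ix k) || (i == ix j) then 0 else v i.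

Lemma monomial_split (F : fieldType) (z : 'I_(n + p) -> F) v :
  monomial z v = z (ix k) ^ v (ix k) * (z (ix j) ^ v (ix j) * monomial z (away v)).
Proof.
rewrite /monomial (bigD1 (ix k)) //= (bigD1 (ix j)) //=; congr (_ * (_ * _)).
rewrite [RHS](bigD1 (ix k)) //= [X in _ = _ * X](bigD1 (ix j)) //=.
rewrite /away !eqxx orbT !expr0z !mul1r.
by apply: eq_bigr => i /andP[/negbTE -> /negbTE ->].
Qed.

Lemma binomial_split_j (F : fieldType) (z : 'I_(n + p) -> F) v b :
  v (ix k) = 0 -> v (ix j) = b%:Z ->
  binomial_at z v = z (ix j) ^+ b * monomial z (away (fun i => pospart (v i)))
                    + monomial z (away (fun i => pospart (- v i))).
Proof.
move=> vk vj; rewrite /binomial_at [X in X + _]monomial_split [X in _ + X]monomial_split.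
rewrite vk vj oppr0 (pospart_eq0 (lexx 0)).
by rewrite pospart_id // pospart_eq0 ?oppr_le0 // !expr0z !mul1r -exprnP.
Qed.

Lemma binomial_split_k (F : fieldType) (z : 'I_(n + p) -> F) v c :
  v (ix j) = 0 -> v (ix k) = c%:Z ->
  binomial_at z v = z (ix k) ^+ c * monomial z (away (fun i => pospart (v i)))
                    + monomial z (away (fun i => pospart (- v i))).
Proof.
move=> vj vk; rewrite /binomial_at [X in X + _]monomial_split [X in _ + X]monomial_split.
rewrite vk vj oppr0 (pospart_eq0 (lexx 0)).
by rewrite pospart_id // pospart_eq0 ?oppr_le0 // !expr0z !mul1r -exprnP.
Qed.

Lemma monomial_away_S v : monomial (svar S) (away v) = monomial y (away v).
Proof.
apply: eq_monomial => // i; rewrite /away; case: ifP => [_|/negbT]; first by left.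
by rewrite negb_or => /andP[ik ij]; right; rewrite two_step_other.
Qed.

Lemma monomial_away_S1 v :
  monomial (svar (mutate k S)) (away v) = monomial y (away v).
Proof.
apply: eq_monomial => // i; rewrite /away; case: ifP => [_|/negbT]; first by left.
by rewrite negb_or => /andP[ik ij]; right; rewrite [RHS]mutate_var_other.
Qed.

Lemma away_unit v : gen_unit (laurent_gen (predC1 (ix j)) y) (monomial y (away v)).
Proof.
apply: monomial_unit => [i _|i /negbNE/eqP ->]; first exact: independent_neq0.
by rewrite /away eqxx orbT.
Qed.

(** The mutation rule in the form needed for the relation EC of the rank two
    computation: when the column of j meets row k negatively, mutation at k
    subtracts from it a multiple of the negative part of the column of k. *)
Lemma two_step_relation_exponent (c : nat) i : B (ix k) j = - c%:Z -> i != ix k ->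
  pospart (- B i j) + pospart (- B i k) * c%:Z + pospart (smat (mutate k S) i j)
  = pospart (B i j) + pospart (- smat (mutate k S) i j).
Proof.
move=> Bkj ik; set b' := smat (mutate k S) i j.
have : b' = B i j - pospart (- B i k) * c%:Z.
  rewrite /b' mutate_matE (negbTE ik) (negbTE jk) /= Bkj opprK [pospart c%:Z]pospart_id //.
  have := pospartB (B i k); move: (pospart (B i k)) (pospart (- B i k)) => u v <-.
  ring.
have := pospartB (B i j); have := pospartB b'.
by move: (pospart (- B i k) * c%:Z) => q; lia.
Qed.

(** The direct application of the rank two computation, with 1 = k and 2 = j.
    The constant C is free of the new j-th variable because column j has a zero
    in row j. *)
Lemma two_step_positive f : 0 < B (ix j) k ->
  in_laurent (mutate k S) f -> in_laurent (mutate j S) f -> in_laurent T f.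
Proof.
move=> Bjk.
have [b Eb] : exists b, B (ix j) k = b.+1%:Z by exists `|B (ix j) k - 1|%N; lia.
have [c Ec] : exists c, B (ix k) j = - c.+1%:Z.
  have := sskew_sign k j skS; rewrite Bjk => Bkj.
  by exists `|(B (ix k) j + 1)%R|%N; lia.
have y0 i : y i != 0 by apply: independent_neq0.
pose A v := monomial y (away v).
pose M1 := A (fun i => pospart (B i k)); pose N1 := A (fun i => pospart (- B i k)).
pose M2 := A (fun i => pospart (- B i j)); pose N2 := A (fun i => pospart (B i j)).
pose W1 := A (fun i => pospart (smat (mutate k S) i j)).
pose W2 := A (fun i => pospart (- smat (mutate k S) i j)).
pose C := binomial_at (svar (mutate k S)) (fun i => smat (mutate k S) i j).
have Ex1 : svar S (ix k) = (svar S (ix j) ^+ b.+1 * M1 + N1) / y (ix k).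
  rewrite two_step_x1 (@binomial_split_j _ _ _ b.+1).
  - by rewrite !monomial_away_S.
  - exact: sskew_diag.
  - exact: Eb.
have Ex2' : svar (mutate j S) (ix j) = (svar S (ix k) ^+ c.+1 * M2 + N2) / svar S (ix j).
  rewrite two_step_x2' binomial_opp (@binomial_split_k _ _ _ c.+1).
  - rewrite !monomial_away_S; congr ((_ + _) / _).
    by apply: eq_monomial => i; [right | rewrite /away opprK].
  - by rewrite sskew_diag.
  - by rewrite Ec opprK.
have EC : C = y (ix k) ^+ c.+1 * W1 + W2.
  rewrite /C (@binomial_split_k _ _ _ c.+1).
  - by rewrite !monomial_away_S1 [y _]mutate_var_other.
  - rewrite mutate_matE (negbTE jk) (negbTE jk') /= sskew_diag // add0r.
    by rewrite Ec opprK (pospart_id (ltW Bjk)) Eb pospart_id //; lia.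
  - by rewrite mutate_mat_row Ec opprK.
have relW : M2 * N1 ^+ c.+1 * W1 = N2 * W2.
  rewrite /M2 /N1 /W1 /N2 /W2 /A exprnP -monomialMn -!monomialD //.
  apply: eq_monomial => i; first by right.
  rewrite /away; case: ifP => [_|/norP[ik _]]; first by rewrite mul0r.
  exact: two_step_relation_exponent.
have UA v : gen_unit (laurent_gen (predC1 (ix j)) y) (A v) by apply: away_unit.
have UA' v : gen_unit Tgen (A v) by exact: (gen_unit_sub (UA v)).
have Uy i : gen_unit Tgen (y i) by apply: gen_unit_svar.
have LA v := gen_unit_in (UA v); have LA' v := gen_unit_in (UA' v).
have Uyk : gen_unit (laurent_gen (predC1 (ix j)) y) (y (ix k)).
  by apply: laurent_unit => //; apply: y0.
have LC : laurent (predC1 (ix j)) y C.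
  rewrite EC; apply: genD; last exact: LA.
  by apply: subring_gen_M; [apply/genX/gen_unit_in | exact: LA].
have C0 : C != 0.
  exact: (numerator_neq0 two_step_x2 (independent_neq0 _ iS)).
have relC : N2 * y (ix k) ^+ c.+1 + M2 * N1 ^+ c.+1 = (N2 / W1) * C.
  have W10 : W1 != 0 by exact: gen_unit_neq0 (UA _).
  by rewrite EC; exact: rank2_unit_relation.
have Uu : gen_unit (laurent_gen (predC1 (ix j)) y) (N2 / W1).
  by apply: gen_unitM; [exact: UA | apply/gen_unitV/UA].
have Lu := gen_unit_in (gen_unit_sub Uu).
have LC' := laurent_sub LC.
have Lx2 := rank2_x2_in (Uy (ix j)) LC' two_step_x2.
have Lx1 := rank2_x1_in (Uy (ix k)) (Uy (ix j)) (UA' _) LC' (LA' _) two_step_x2 Ex1.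
have Lx2' := rank2_x2'_in (Uy (ix k)) (Uy (ix j)) (UA' _) LC' C0 (LA' _) (LA' _) Lu
  two_step_x2 Ex1 Ex2' relC.
have cop1 := rank2_coprime_x2_x1 (Uy (ix k)) (Uy (ix j)) (UA' _) LC' (LA' _)
  two_step_x2 Ex1.
apply: (two_step_of_coprime jk iS iS2 iT Lx1 Lx2 Lx2' cop1).
apply: (rank2_coprime_x2_x2' (Uy (ix k)) (Uy (ix j)) (UA' _) LC' C0 (LA' _) (LA' _)
  two_step_x2 Ex1 Ex2' relC).
rewrite -[X in _ * X]expr1; apply: (gauss_coprime iT LC C0 _ Uu).
rewrite /rank2_constant; apply: subring_gen_M.
  apply: subring_gen_M; first exact: LA.
  by apply: subring_gen_M; [apply/genX/gen0 | exact: LA].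
by rewrite -mulr_natr; apply: subring_gen_M; [apply/genX/LA | apply: gen_nat].
Qed.

End Pair.

End TwoStep.

(** * Invariance of the upper bound *)

Section UpperBound.
Variables (n p : nat).
Implicit Types (S : seed n p) (j k : 'I_n).
Local Notation ix := (lshift p).

Lemma two_step S j k f : j != k -> sskew S -> full_rank S ->
  independent (svar S) -> independent (svar (mutate j S)) ->
  independent (svar (mutate j (mutate k S))) ->
  in_laurent (mutate k S) f -> in_laurent (mutate j S) f ->
  in_laurent (mutate j (mutate k S)) f.
Proof.
move=> jk skS fr iS iS2 iT.
case: (ltrgtP (smat S (ix j) k) 0) => [Bjk|Bjk|Bjk].
- have := @two_step_positive _ _ (opp_seed S) j k jk (sskew_opp skS).
  rewrite !mutate_opp => H; apply: H => //.
  by rewrite /= mxE oppr_gt0.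
- exact: two_step_positive.
- apply: two_step_commuting => //; exact: full_rank_columns.
Qed.

Lemma totally_mutable_mutate k S : totally_mutable S -> totally_mutable (mutate k S).
Proof. by move=> tS ks; have [] := tS (k :: ks). Qed.

Lemma totally_mutable_sskew k S : totally_mutable S -> sskew (mutate k S).
Proof. by move=> tS; have [] := tS [:: k]. Qed.

(** Independence of the variables is the only part of the definition of a
    free generating set that has to be followed along mutations. *)
Definition regular S := [/\ totally_mutable S, sskew S & independent (svar S)].

Lemma regular_mutate k S : regular S -> regular (mutate k S).
Proof.
case=> tS skS iS; split; first exact: totally_mutable_mutate.
  exact: totally_mutable_sskew.
exact: independent_mutate.
Qed.

Lemma regular_neq0 S i : regular S -> svar S i != 0.
Proof. by case=> _ _ iS; apply: independent_neq0. Qed.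

Lemma regular_exchange_neq0 S k : regular S -> exchange_binomial k S != 0.
Proof.
move=> rS; apply: (numerator_neq0 (mutate_var_same k S)).
exact: regular_neq0 (regular_mutate k rS).
Qed.

Lemma regular_mutateK S k : regular S -> mutate k (mutate k S) = S.
Proof.
move=> rS; case: (rS) => _ skS iS; apply: mutateK => //.
  exact: regular_neq0.
exact: regular_exchange_neq0.
Qed.

Definition in_upper_bound S f := in_laurent S f /\ forall k, in_laurent (mutate k S) f.

(** Of the neighbours of mu_k S, one is S itself and the others are reached by
    two_step. *)
Lemma upper_bound_mutate S k f : regular S -> full_rank S ->
  in_upper_bound S f -> in_upper_bound (mutate k S) f.
Proof.
move=> rS fr [Lf Lfk]; split=> // j; have [->|jk] := eqVneq j k.
  by rewrite regular_mutateK.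
case: (rS) => tS skS iS; apply: two_step => //.
  exact: independent_mutate.
by case: (regular_mutate j (regular_mutate k rS)).
Qed.

Lemma upper_bound_mutate_seq S ks f : regular S -> full_rank S ->
  in_upper_bound S f -> in_laurent (mutate_seq S ks) f.
Proof.
elim: ks S => [|k ks IH] S rS fr uf; first by case: uf.
apply: IH; first exact: regular_mutate.
  by apply: full_rank_mutate => //; case: rS.
exact: upper_bound_mutate.
Qed.

Lemma regular_mutate_seq S ks : regular S -> regular (mutate_seq S ks).
Proof. by elim: ks S => [//|k ks IH] S rS; apply/IH/regular_mutate. Qed.

Lemma mutate_seq_cat S ks ls : mutate_seq S (ks ++ ls) = mutate_seq (mutate_seq S ks) ls.
Proof. exact: foldl_cat. Qed.

Lemma mutate_seq_rev S ks : regular S -> mutate_seq (mutate_seq S ks) (rev ks) = S.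
Proof.
elim: ks S => [//|k ks IH] S rS; rewrite rev_cons -cats1 mutate_seq_cat /=.
by rewrite (IH (mutate k S) (regular_mutate k rS)) regular_mutateK.
Qed.

End UpperBound.

(** * Factorization into slices *)

Section Factorization.
Variables (n p : nat) (S : seed n p).
Local Notation ix := (lshift p).
Local Notation x := (svar S).
Local Notation B := (smat S).

Definition head_term k := monomial x (fun i => pospart (B i k)).
Definition tail_term k := monomial x (fun i => pospart (- B i k)).

Lemma extend_mat_mutable i j : extend_mat B i (ix j) = B i j.
Proof.
by rewrite /extend_mat; case: (split_ordP i) => i' ->; rewrite (block_mxEul, block_mxEdl) mxE.
Qed.

Lemma extend_mat_sign i j : sskew S ->
  (0 < extend_mat B (ix i) j) = (B j i < 0).
Proof.
move=> skS; case: (split_ordP j) => j' ->; last first.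
  by rewrite /extend_mat block_mxEur !mxE oppr_gt0.
by rewrite extend_mat_mutable sskew_sign.
Qed.

Variable a : 'I_n -> int.

Lemma extend_s_mutable (s : s_all a) i : extend_s s (ix i) = s i.
Proof.
rewrite /extend_s; case: split_ordP => j; last by move/eqP; rewrite eq_lrshift.
by move/lshift_inj => ->.
Qed.

Lemma extend_s_frozen (s : s_all a) i : extend_s s (rshift n i : 'I_(n + p)) = [::].
Proof.
by rewrite /extend_s; case: split_ordP => j // /esym/eqP; rewrite eq_lrshift.
Qed.

Lemma weight_nil : weight [::] = 0.
Proof. by rewrite /weight big_nil. Qed.

(** Grouping the factors by the sequence in the exponent, instead of by edges,
    makes them powers of the head and tail monomials of the exchange relations:
    sign-skew-symmetry turns the edges leaving i into the negative entries of
    column i. *)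
Lemma xtilde_terms : sskew S -> xtilde S a =
  (\prod_(l < n) x (ix l) ^ (- a l)) *
  \sum_(s in s_gcc S a)
    \prod_k (head_term k ^+ weight (bar (s k)) * tail_term k ^+ weight (s k)).
Proof.
move=> skS; congr (_ * _); apply: eq_bigr => s _.
rewrite !big_split /=; congr (_ * _).
  rewrite big_mkcond /=.
  pose F i j := if 0 < extend_mat B i j
    then x i ^ (extend_mat B i j * weight (bar (extend_s s j))) else 1.
  rewrite (eq_bigr (fun ij => F ij.1 ij.2)) // -(pair_bigA _ F) exchange_big /=.
  rewrite big_split_ord /= [X in _ * X]big1 ?mulr1 => [|j _]; last first.
    rewrite big1 // => i _; rewrite /F extend_s_frozen weight_nil mulr0 expr0z.
    by case: ifP.
  apply: eq_bigr => j _; rewrite exprnP -monomialMn; apply: eq_bigr => i _.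
  rewrite /F extend_mat_mutable extend_s_mutable [pospart (B i j)]pospartE.
  by case: ifP => // _; rewrite mul0r expr0z.
rewrite big_mkcond /=.
pose F i j := if 0 < extend_mat B i j
  then x j ^ (- extend_mat B j i * weight (extend_s s i)) else 1.
rewrite (eq_bigr (fun ij => F ij.1 ij.2)) // -(pair_bigA _ F) /=.
rewrite big_split_ord /= [X in _ * X]big1 ?mulr1 => [|i _]; last first.
  rewrite big1 // => j _; rewrite /F extend_s_frozen weight_nil mulr0 expr0z.
  by case: ifP.
apply: eq_bigr => i _; rewrite exprnP -monomialMn; apply: eq_bigr => j _.
rewrite /F extend_mat_mutable extend_s_mutable extend_mat_sign // [pospart (- B j i)]pospartE
  oppr_gt0.
by case: ifP => // _; rewrite mul0r expr0z.
Qed.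

(** The condition on s restricted to one position r, where D is the set of the
    i whose sequence is long enough to have a letter there.  Outside D the value
    of t is normalized to false, so that t is determined by its restriction to D. *)
Definition compatible (D : pred 'I_n) (t : {ffun 'I_n -> bool}) :=
  [forall i, t i ==> D i] &&
  [forall i, forall j, [&& 0 < B (ix i) j, D i, D j & t i] ==> t j].

Definition slice_sum D :=
  \sum_(t | compatible D t) \prod_(k | D k) (if t k then tail_term k else head_term k).

Lemma prod_by_weight (F : fieldType) (u v : F) t :
  u ^+ weight (bar t) * v ^+ weight t = \prod_(r < size t) (if nth false t r then v else u).
Proof.
elim: t => [|b t IH]; first by rewrite /weight !big_nil big_ord0 mulr1.
rewrite /weight /bar /= !big_cons -/(weight _) -/(weight _) big_ord_recl /= -IH.
by case: b; rewrite /= !exprD !expr1 !expr0; ring.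
Qed.

Local Notation len k := `|pospart (a k)|%N.

Definition level r : pred 'I_n := fun k => (r < len k)%N.

Definition depth := (\max_k len k)%N.

(** The letters of s arranged by position; entries beyond the length of a
    sequence are false. *)
Definition columns := {ffun 'I_depth -> {ffun 'I_n -> bool}}.

Definition column_entry (f : columns) r k := if insub r is Some r' then f r' k else false.

Definition sequences_of (f : columns) : s_all a :=
  [ffun k => [tuple column_entry f r k | r < len k]].

Definition columns_of (s : s_all a) : columns :=
  [ffun r : 'I_depth => [ffun k => nth false (s k) r]].

Lemma columns_ofE s r k : columns_of s r k = nth false (s k) r.
Proof. by rewrite !ffunE. Qed.

Lemma level_lt_depth r k : level r k -> (r < depth)%N.
Proof. by move=> rk; apply: leq_trans rk (leq_bigmax k). Qed.

Lemma column_entryE (f : columns) (r : 'I_depth) k : column_entry f r k = f r k.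
Proof. by rewrite /column_entry valK. Qed.

Lemma nth_sequences_of f r k :
  nth false (sequences_of f k) r = level r k && column_entry f r k.
Proof.
rewrite ffunE /level; case: ltnP => [rk|kr]; last by rewrite nth_default // size_tuple.
by rewrite (nth_map (Ordinal rk)) ?size_enum_ord //= nth_enum_ord.
Qed.

Lemma columns_ofK : cancel columns_of sequences_of.
Proof.
move=> s; apply/ffunP => k; apply/eq_from_tnth => r.
rewrite !(tnth_nth false) nth_sequences_of /level ltn_ord /=.
have rN : (r < depth)%N by apply: (level_lt_depth (k := k)); apply: ltn_ord.
by rewrite /column_entry insubT /= columns_ofE.
Qed.

Lemma dot_eq0 (t t' : seq bool) : reflect
  (forall r, (r < size t')%N -> nth false t r -> nth false t' r) (dot t (bar t') == 0%N).
Proof.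
apply: (iffP idP) => [/eqP|H].
  rewrite /dot => /eqP; rewrite sum_nat_eq0 => /forallP H r rt' tr.
  have rt : (r < size t)%N.
    by rewrite ltnNge; apply: contraL tr => /(nth_default false) ->.
  have rm : (r < minn (size t) (size (bar t')))%N by rewrite size_map leq_min rt.
  have := H (Ordinal rm); rewrite /= tr (nth_map false) // muln_eq0 /=.
  by case: (nth _ t' r).
rewrite /dot sum_nat_eq0; apply/forallP => -[r /= rm].
move: rm; rewrite leq_min size_map => /andP[rt rt'].
rewrite (nth_map false) // muln_eq0; case: (boolP (nth false t r)) => //= tr.
by rewrite H.
Qed.

(** The condition on s only compares letters in the same position, so it can be
    checked one column at a time. *)
Lemma sequences_of_gcc f :
  (sequences_of f \in s_gcc S a) && (columns_of (sequences_of f) == f)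
  = (f \in family (fun r : 'I_depth => compatible (level r))).
Proof.
apply/andP/familyP => [[gcc /eqP fK] r|H].
  rewrite unfold_in; apply/andP; split.
    apply/forallP => i; apply/implyP; rewrite -fK columns_ofE.
    by rewrite nth_sequences_of => /andP[].
  apply/forallP => i; apply/forallP => j; apply/implyP => /and4P[Bij Di Dj].
  move: gcc; rewrite inE => /forallP/(_ i)/forallP/(_ j)/implyP; rewrite principalE.
  move=> /(_ Bij)/dot_eq0/(_ r); rewrite size_tuple => /(_ Dj).
  by rewrite !nth_sequences_of !column_entryE Di Dj.
have fD (r : 'I_depth) i : f r i -> level r i.
  by have := H r; rewrite unfold_in => /andP[/forallP/(_ i)/implyP].
split; last first.
  apply/eqP/ffunP => r; apply/ffunP => k; rewrite columns_ofE nth_sequences_of.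
  by rewrite column_entryE andb_idl //; apply: fD.
rewrite inE; apply/forallP => i; apply/forallP => j; apply/implyP; rewrite principalE => Bij.
apply/dot_eq0 => r; rewrite size_tuple => Dj; rewrite !nth_sequences_of => /andP[Di].
rewrite /level Dj /= /column_entry insubT; first exact: level_lt_depth Dj.
move=> rN; have := H (Sub r rN); rewrite unfold_in => /andP[_ /forallP/(_ i)/forallP/(_ j)].
by rewrite SubK Bij Di (Dj : level r j) => /implyP.
Qed.

Lemma prod_level (F : fieldType) (u : nat -> 'I_n -> F) :
  \prod_k \prod_(r < len k) u r k = \prod_(r < depth) \prod_(k | level r k) u r k.
Proof.
rewrite (exchange_big_dep predT) //=; apply: eq_bigr => k _.
by rewrite (big_ord_widen depth (fun r => u r k)) // leq_bigmax.
Qed.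

Lemma sum_gcc_slices :
  \sum_(s in s_gcc S a)
    \prod_k (head_term k ^+ weight (bar (s k)) * tail_term k ^+ weight (s k))
  = \prod_(r < depth) slice_sum (level r).
Proof.
rewrite /slice_sum bigA_distr_big_dep.
rewrite (reindex_onto sequences_of columns_of) => [|s _]; last exact: columns_ofK.
rewrite (eq_bigl _ _ sequences_of_gcc); apply: eq_bigr => f _.
transitivity (\prod_(r < depth) \prod_(k | level r k)
   (if column_entry f r k then tail_term k else head_term k)); last first.
  by apply: eq_bigr => r _; apply: eq_bigr => k _; rewrite column_entryE.
rewrite -(prod_level (fun r k => if column_entry f r k then tail_term k else head_term k)).
apply: eq_bigr => k _; rewrite prod_by_weight size_tuple; apply: eq_bigr => r _.
by rewrite nth_sequences_of /level ltn_ord.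
Qed.

Definition slice D := \prod_(l | D l) (x (ix l))^-1 * slice_sum D.

(** A positive a_l contributes one factor x_l^-1 to each of the first a_l slices;
    a negative one is kept apart. *)
Lemma xtilde_slices : sskew S -> (forall i, x i != 0) -> xtilde S a =
  (\prod_(l < n) x (ix l) ^+ `|pospart (- a l)|%N) * \prod_(r < depth) slice (level r).
Proof.
move=> skS x0; rewrite xtilde_terms // sum_gcc_slices /slice [in RHS]big_split mulrA.
congr (_ * _); rewrite -(prod_level (fun _ l => (x (ix l))^-1)) -big_split.
apply: eq_bigr => l _ /=; rewrite prodr_const card_ord exprVn exprnN exprnP -expfzDr //.
by congr (_ ^ _); rewrite !gez0_abs ?pospart_ge0 // /pospart; lia.
Qed.

End Factorization.

(** * Slices lie in the upper bound *)

Section SliceMembership.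
Variables (n p : nat) (S : seed n p).
Local Notation ix := (lshift p).
Local Notation x := (svar S).
Local Notation B := (smat S).
Hypothesis rS : regular S.

Let skS : sskew S. Proof. by case: rS. Qed.
Let x0 i : x i != 0. Proof. exact: regular_neq0. Qed.

Let gen_pos_monomial (G : ratfun (n + p) -> Prop) v :
  (forall i, subring_gen G (x i)) -> (forall i, 0 <= v i) ->
  subring_gen G (monomial x v).
Proof.
move=> Lx v0; apply: gen_prod => i _; rewrite -[v i]gez0_abs //.
exact: genX.
Qed.

Lemma slice_in_laurent D : in_laurent S (slice S D).
Proof.
have Ux i : gen_unit (laurent_gen predT x) (x i) by apply: laurent_unit.
have Lx i : in_laurent S (x i) by apply: gen_unit_in.
apply: subring_gen_M.
  by apply: gen_prod => l _; apply: gen_unit_inv.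
apply: gen_sum => t _; apply: gen_prod => k _.
by case: ifP => _; apply: gen_pos_monomial => // i; apply: pospart_ge0.
Qed.

Section Direction.
Variable k : 'I_n.
Local Notation Lgen := (laurent_gen predT (svar (mutate k S))).
Local Notation L := (in_laurent (mutate k S)).

Let xk := x (ix k).

Let L_other i : i != ix k -> gen_unit Lgen (x i).
Proof.
move=> ik; rewrite -(mutate_var_other S ik); apply: laurent_unit => //.
exact: regular_neq0 (regular_mutate k rS).
Qed.

Lemma exchange_quotient_in : L (xk^-1 * exchange_binomial k S).
Proof.
rewrite mulrC -mutate_var_same; apply: gen_unit_in; apply: laurent_unit => //.
exact: regular_neq0 (regular_mutate k rS).
Qed.

Lemma mutated_var_in i : L (x i).
Proof.
have [->|ik] := eqVneq i (ix k); last by apply: gen_unit_in; apply: L_other.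
rewrite (div_swap (mutate_var_same k S)); last first.
  exact: regular_neq0 (regular_mutate k rS).
apply: subring_gen_M; last first.
  apply: gen_unit_inv; apply: laurent_unit => //.
  exact: regular_neq0 (regular_mutate k rS).
have Px v : (forall i, v i = 0 \/ i != ix k) -> (forall i, 0 <= v i) ->
    L (monomial x v).
  move=> vk v0; apply: gen_prod => l _; case: (vk l) => [->|lk].
    by rewrite expr0z; apply: subring_gen_1.
  by apply: gen_unit_in; apply/gen_unitXz/L_other.
have Ek (u : 'I_(n + p) -> int) : u (ix k) = 0 -> forall l, u l = 0 \/ l != ix k.
  by move=> u0 l; have [->|] := eqVneq l (ix k); [left|right].
have Bkk := sskew_diag k skS.
apply: genD; apply: Px => [l|l]; try exact: pospart_ge0.
  by apply: (Ek (fun l => pospart (B l k))); rewrite Bkk pospart_eq0.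
by apply: (Ek (fun l => pospart (- B l k))); rewrite Bkk pospart_eq0.
Qed.

Lemma divisible_monomial v : (forall i, 0 <= v i) -> 0 < v (ix k) ->
  L (xk^-1 * monomial x v).
Proof.
move=> v0 vk; have [e ve] : exists e, v (ix k) = e.+1%:Z.
  by exists `|v (ix k) - 1|%N; lia.
rewrite /monomial (bigD1 (ix k)) //= ve -exprnP exprS -mulrA mulKf; last exact: x0.
apply: subring_gen_M; first exact/genX/mutated_var_in.
apply: gen_prod => i _; rewrite -[v i]gez0_abs //.
exact/genX/mutated_var_in.
Qed.

Definition flip (t : {ffun 'I_n -> bool}) : {ffun 'I_n -> bool} :=
  [ffun i => if i == k then ~~ t i else t i].

Lemma flipK : involutive flip.
Proof. by move=> t; apply/ffunP => i; rewrite !ffunE; case: eqP => // _; rewrite negbK. Qed.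

(** If the values of t at the neighbours of k in D are those that impose nothing
    on t_k, then t_k may be chosen freely. *)
Lemma compatible_flip (D : pred 'I_n) (t : {ffun 'I_n -> bool}) : D k ->
  (forall l, l != k -> D l -> 0 < B (ix k) l -> t l) ->
  (forall l, l != k -> D l -> B (ix k) l < 0 -> ~~ t l) ->
  compatible S D t -> compatible S D (flip t).
Proof.
move=> Dk pos neg /andP[/forallP tD /forallP tgcc]; apply/andP; split.
  apply/forallP => i; rewrite ffunE; case: eqP => [->|_]; last exact: tD.
  by rewrite Dk implybT.
apply/forallP => i; apply/forallP => j; apply/implyP => /and4P[Bij Di Dj].
have := forallP (tgcc i) j; rewrite Bij Di Dj /= !ffunE.
move=> /implyP tij; have [jk|jk] := eqVneq j k; have [ik|ik] := eqVneq i k.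
- by move: Bij; rewrite jk ik sskew_diag.
- have Bki : B (ix k) i < 0 by rewrite (sskew_sign _ _ skS) -jk.
  by rewrite (negbTE (neg i ik Di Bki)).
- by move=> _; apply: pos => //; rewrite -ik.
- exact: tij.
Qed.

(** A neighbour l whose value restricts t_k contributes a monomial containing
    x_k. *)
Let row_divisible (D : pred 'I_n) (t : {ffun 'I_n -> bool}) l : l != k -> D l ->
  (0 < B (ix k) l) && ~~ t l || (B (ix k) l < 0) && t l ->
  L (xk^-1 * \prod_(i | D i && (i != k)) (if t i then tail_term S i else head_term S i)).
Proof.
move=> lk Dl H; rewrite (bigD1 l) ?Dl //= mulrA; apply: subring_gen_M; last first.
  by apply: gen_prod => i _; case: ifP => _; apply: gen_pos_monomial => [|j];
    rewrite ?pospart_ge0 //; apply: mutated_var_in.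
case/orP: H => /andP[B0]; last (move=> ->); first (move/negbTE => ->);
  apply: divisible_monomial => [i|]; rewrite ?pospart_ge0 //.
  by rewrite pospart_id // ltW.
by rewrite pospart_id ?oppr_ge0 ?oppr_gt0 // ltW.
Qed.

(** The terms are paired by flipping t_k.  Either the common factor R t of the
    two terms is divisible by x_k, or both terms are present and their sum is
    R t times the exchange binomial x_k x_k'. *)
Lemma slice_sum_divisible (D : pred 'I_n) : D k -> L (xk^-1 * slice_sum S D).
Proof.
move=> Dk.
pose R (t : {ffun 'I_n -> bool}) :=
  \prod_(i | D i && (i != k)) (if t i then tail_term S i else head_term S i).
have RE (t : {ffun 'I_n -> bool}) :
    \prod_(i | D i) (if t i then tail_term S i else head_term S i)
    = (if t k then tail_term S k else head_term S k) * R t by rewrite (bigD1 k).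
have Rflip t : R (flip t) = R t.
  by apply: eq_bigr => i /andP[_ /negbTE ik]; rewrite ffunE ik.
have -> : slice_sum S D = \sum_(t : {ffun 'I_n -> bool} | t k)
    ((if compatible S D t then tail_term S k * R t else 0)
     + (if compatible S D (flip t) then head_term S k * R t else 0)).
  rewrite big_split /= /slice_sum (bigID (fun t : {ffun 'I_n -> bool} => t k)) /=.
  congr (_ + _).
    rewrite -big_mkcondr; apply: eq_big => t; first by rewrite andbC.
    by move=> /andP[_ tk]; rewrite RE tk.
  rewrite (reindex_inj (inv_inj flipK)) -big_mkcondr.
  apply: eq_big => t; first by rewrite ffunE eqxx negbK andbC.
  by move=> /andP[_ /negbTE tk]; rewrite RE tk Rflip.
have LT i : L (tail_term S i).
  by apply: gen_pos_monomial => [|j]; [apply: mutated_var_in | apply: pospart_ge0].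
have LH i : L (head_term S i).
  by apply: gen_pos_monomial => [|j]; [apply: mutated_var_in | apply: pospart_ge0].
rewrite mulr_sumr; apply: gen_sum => t tk.
have [/existsP[l /and3P[lk Dl H]]|/existsPn none] := boolP [exists l, [&& l != k, D l &
    (0 < B (ix k) l) && ~~ t l || (B (ix k) l < 0) && t l]].
  (* Some neighbour of k makes R t divisible by x_k. *)
  have LR := row_divisible lk Dl H.
  rewrite mulrDr; apply: genD; case: ifP => _; rewrite ?mulr0; try exact: gen0.
    by rewrite mulrCA; exact: (subring_gen_M (LT k) LR).
  by rewrite mulrCA; exact: (subring_gen_M (LH k) LR).
(* No neighbour restricts t_k, so both terms occur or none does. *)
have pos l : l != k -> D l -> 0 < B (ix k) l -> t l.
  by move=> lk Dl Bl; have := none l; rewrite lk Dl Bl /= negb_or negbK => /andP[].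
have neg l : l != k -> D l -> B (ix k) l < 0 -> ~~ t l.
  by move=> lk Dl Bl; have := none l; rewrite lk Dl Bl /= negb_or => /andP[].
have -> : compatible S D (flip t) = compatible S D t.
  apply/idP/idP; last exact: compatible_flip.
  rewrite -{2}[t]flipK; apply: compatible_flip => // l lk Dl; rewrite ffunE (negbTE lk).
    exact: pos.
  exact: neg.
case: ifP => _; last by rewrite addr0 mulr0; apply: gen0.
rewrite -mulrDl mulrA; apply: subring_gen_M; last first.
  apply: gen_prod => i _; case: ifP => _; [exact: LT|exact: LH].
by rewrite addrC; apply: exchange_quotient_in.
Qed.

Lemma slice_in_mutated D : L (slice S D).
Proof.
have Linv (P : pred 'I_n) : ~~ P k -> L (\prod_(l | P l) (x (ix l))^-1).
  move=> nPk; apply: gen_prod => l Pl; apply: gen_unit_inv; apply: L_other.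
  by rewrite (inj_eq (@lshift_inj _ _)); apply: contraNneq nPk => <-.
have [Dk|nDk] := boolP (D k); last first.
  apply: subring_gen_M; first exact: Linv.
  apply: gen_sum => t _; apply: gen_prod => i _; case: ifP => _;
    by apply: gen_pos_monomial => [|j]; [apply: mutated_var_in | apply: pospart_ge0].
rewrite /slice (bigD1 k) //= mulrAC; apply: subring_gen_M.
  exact: slice_sum_divisible.
by apply: Linv; rewrite eqxx andbF.
Qed.

End Direction.

Lemma xtilde_in_upper_bound a : in_upper_bound S (xtilde S a).
Proof.
rewrite xtilde_slices //; split=> [|k].
  apply: subring_gen_M; apply: gen_prod => i _; last exact: slice_in_laurent.
  by apply/genX/gen_unit_in/laurent_unit.
apply: subring_gen_M; apply: gen_prod => i _; last exact: slice_in_mutated.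
exact/genX/mutated_var_in.
Qed.

End SliceMembership.

(** * Specialization of fractions *)

Section Specialization.
Variables (R : idomainType) (K : fieldType) (h : {rmorphism R -> K}).
Local Notation tofrac := (@FracField.tofrac R).

(** The graph of h extended to the fractions that have a denominator outside
    the kernel of h; a relation spares the construction of a localization. *)
Definition specializes (f : {fraction R}) (g : K) := exists P Q,
  [/\ h Q != 0, f = tofrac P / tofrac Q & g = h P / h Q].

Let tofrac_neq0 Q : h Q != 0 -> tofrac Q != 0.
Proof. by rewrite tofrac_eq0; apply: contraNneq => ->; rewrite rmorph0. Qed.

Lemma specializes_tofrac P : specializes (tofrac P) (h P).
Proof. by exists P, 1; rewrite !rmorph1 !divr1 oner_neq0. Qed.

Let subf_div (F : fieldType) (a b c d : F) : b != 0 -> d != 0 ->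
  a / b - c / d = (a * d - c * b) / (b * d).
Proof. by move=> b0 d0; field; rewrite b0 d0. Qed.

Let mulf_divs (F : fieldType) (a b c d : F) : b != 0 -> d != 0 ->
  (a / b) * (c / d) = (a * c) / (b * d).
Proof. by move=> b0 d0; field; rewrite b0 d0. Qed.

Lemma specializesB f g f' g' : specializes f g -> specializes f' g' ->
  specializes (f - f') (g - g').
Proof.
move=> [P [Q [Q0 -> ->]]] [P' [Q' [Q0' -> ->]]].
exists (P * Q' - P' * Q), (Q * Q'); rewrite !(rmorphB, rmorphM) /=; split.
- exact: mulf_neq0.
- by apply: subf_div; apply: tofrac_neq0.
- exact: subf_div.
Qed.

Lemma specializesM f g f' g' : specializes f g -> specializes f' g' ->
  specializes (f * f') (g * g').
Proof.
move=> [P [Q [Q0 -> ->]]] [P' [Q' [Q0' -> ->]]].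
exists (P * P'), (Q * Q'); rewrite !rmorphM /=; split.
- exact: mulf_neq0.
- by apply: mulf_divs; apply: tofrac_neq0.
- exact: mulf_divs.
Qed.

Lemma specializesV f g : specializes f g -> g != 0 -> specializes f^-1 g^-1.
Proof.
move=> [P [Q [Q0 -> ->]]] PQ0; exists Q, P; rewrite !invf_div; split=> //.
by move: PQ0; rewrite mulf_eq0 negb_or => /andP[].
Qed.

Lemma specializes_inj f g g' : specializes f g -> specializes f g' -> g = g'.
Proof.
move=> [P [Q [Q0 -> ->]]] [P' [Q' [Q0' E ->]]].
have /tofrac_neq0 Qf := Q0; have /tofrac_neq0 Qf' := Q0'.
have : tofrac (P * Q') = tofrac (P' * Q).
  by rewrite !rmorphM /=; apply/eqP; rewrite -eqr_div //; apply/eqP.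
move/eqP; rewrite -subr_eq0 -rmorphB tofrac_eq0 subr_eq0 => /eqP/(congr1 h).
by rewrite !rmorphM => /eqP; rewrite -eqr_div // => /eqP.
Qed.

Lemma specializes0 : specializes 0 0.
Proof.
rewrite -[X in specializes X](rmorph0 tofrac) -(rmorph0 h).
exact: specializes_tofrac.
Qed.

Lemma specializes1 : specializes 1 1.
Proof.
rewrite -[X in specializes X](rmorph1 tofrac) -(rmorph1 h).
exact: specializes_tofrac.
Qed.

Lemma specializesD f g f' g' : specializes f g -> specializes f' g' ->
  specializes (f + f') (g + g').
Proof.
move=> sf sf'; rewrite -[f']opprK -[g']opprK -[- f']sub0r -[- g']sub0r.
by apply: specializesB => //; apply/specializesB/sf'/specializes0.
Qed.

Lemma specializesX f g k : specializes f g -> specializes (f ^+ k) (g ^+ k).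
Proof.
move=> sf; elim: k => [|k IH]; first exact: specializes1.
by rewrite !exprS; apply: specializesM.
Qed.

Lemma specializesXz f g (k : int) : specializes f g -> g != 0 ->
  specializes (f ^ k) (g ^ k).
Proof.
move=> sf g0; case: k => k; first exact: specializesX.
by apply: specializesV; [apply: specializesX | apply: expf_neq0].
Qed.

Lemma specializes_sum (I : Type) (r : seq I) (P : pred I) f g :
  (forall i, P i -> specializes (f i) (g i)) ->
  specializes (\sum_(i <- r | P i) f i) (\sum_(i <- r | P i) g i).
Proof.
by move=> fg; elim/big_ind2: _ => //; [apply: specializes0 | move=> *; apply: specializesD].
Qed.

Lemma specializes_prod (I : Type) (r : seq I) (P : pred I) f g :
  (forall i, P i -> specializes (f i) (g i)) ->
  specializes (\prod_(i <- r | P i) f i) (\prod_(i <- r | P i) g i).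
Proof.
by move=> fg; elim/big_ind2: _ => //; [apply: specializes1 | move=> *; apply: specializesM].
Qed.

End Specialization.

(** * Adding frozen variables *)

Section Extension.
Variables (n p : nat).

Definition old_index (i : 'I_(n + p)) : 'I_(n + (p + n)) :=
  match split i with inl k => lshift (p + n) k | inr j => rshift n (lshift n j) end.

Definition new_index (l : 'I_n) : 'I_(n + (p + n)) := rshift n (rshift p l).

Lemma old_index_mutable k : old_index (lshift p k) = lshift (p + n) k.
Proof. by rewrite /old_index (unsplitK (inl k)). Qed.

Lemma old_index_frozen j : old_index (rshift n j) = rshift n (lshift n j).
Proof. by rewrite /old_index (unsplitK (inr j)). Qed.

Lemma old_index_eq i k : (old_index i == lshift (p + n) k) = (i == lshift p k).
Proof.
case: (split_ordP i) => i' ->; rewrite ?old_index_mutable ?old_index_frozen.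
  by rewrite !(inj_eq (@lshift_inj _ _)).
by rewrite !eq_rlshift.
Qed.

Lemma new_index_neq l k : (new_index l == lshift (p + n) k) = false.
Proof. exact: eq_rlshift. Qed.

Lemma extended_indexP (P : 'I_(n + (p + n)) -> Prop) :
  (forall i, P (old_index i)) -> (forall l, P (new_index l)) -> forall i, P i.
Proof.
move=> Po Pn i; case: (split_ordP i) => [k ->|j ->].
  by rewrite -old_index_mutable.
by case: (split_ordP j) => [f ->|l ->]; [rewrite -old_index_frozen | apply: Pn].
Qed.

Lemma prod_extended (F : fieldType) (f : 'I_(n + (p + n)) -> F) :
  \prod_i f i = (\prod_i f (old_index i)) * \prod_l f (new_index l).
Proof.
rewrite !big_split_ord /= mulrA; congr (_ * _ * _); apply: eq_bigr => i _.
  by rewrite old_index_mutable.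
by rewrite old_index_frozen.
Qed.

Definition extends_matrix (T' : seed n (p + n)) (T : seed n p) :=
  forall i j, smat T' (old_index i) j = smat T i j.

Lemma extends_matrix_principal T' T : extends_matrix T' T ->
  usubmx (smat T') = usubmx (smat T).
Proof.
by move=> e; apply/matrixP => i j; rewrite !principalE -old_index_mutable e.
Qed.

Lemma extends_matrix_mutate T' T k : extends_matrix T' T ->
  extends_matrix (mutate k T') (mutate k T).
Proof.
move=> e i j; rewrite !mutate_matE old_index_eq e.
by rewrite -(old_index_mutable k) !e.
Qed.

Lemma mutable_along_extends T' T ks : extends_matrix T' T ->
  mutable_along T ks -> mutable_along T' ks.
Proof.
elim: ks T' T => [//|k ks IH] T' T e /= [wd ml]; have e' := extends_matrix_mutate k e.
split; last exact: IH ml.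
by rewrite /well_defined_mutation (extends_matrix_principal e').
Qed.

Section Values.
Variable h : {rmorphism {mpoly rat[n + (p + n)]} -> ratfun (n + p)}.

(** New variables specialize to 1.  The new rows of the matrix of T' are
    arbitrary, since mutation changes them. *)
Definition extends (T' : seed n (p + n)) (T : seed n p) :=
  [/\ extends_matrix T' T,
      forall i, specializes h (svar T' (old_index i)) (svar T i)
    & forall l, specializes h (svar T' (new_index l)) 1].

Lemma extends_monomial T' T v' v : extends T' T -> (forall i, svar T i != 0) ->
  (forall i, v' (old_index i) = v i) ->
  specializes h (monomial (svar T') v') (monomial (svar T) v).
Proof.
move=> [_ eo en] T0 vv; rewrite /monomial prod_extended -[X in specializes _ _ X]mulr1.
apply: specializesM.
  by apply: specializes_prod => i _; rewrite vv; apply: specializesXz; [exact: eo|exact: T0].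
have E : \prod_(l < n) (1 : ratfun (n + p)) ^ v' (new_index l) = 1.
  by apply: big1 => l _; apply: exp1rz.
rewrite -[X in specializes _ _ X]E; apply: specializes_prod => l _.
by apply: specializesXz; [apply: en | apply: oner_neq0].
Qed.

Lemma extends_mutate T' T k : extends T' T -> (forall i, svar T i != 0) ->
  extends (mutate k T') (mutate k T).
Proof.
move=> eT T0; case: (eT) => em eo en; split; first exact: extends_matrix_mutate.
  move=> i; have [->|ik] := eqVneq i (lshift p k).
    rewrite old_index_mutable !mutate_var_same; apply: specializesM.
      by apply: specializesD; apply: extends_monomial => // l; rewrite em.
    by rewrite -old_index_mutable; apply: specializesV; [exact: eo | exact: T0].
  by rewrite !mutate_var_other ?old_index_eq.
by move=> l; rewrite mutate_var_other ?new_index_neq.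
Qed.

Lemma extends_mutate_seq T' T ks : regular T -> extends T' T ->
  extends (mutate_seq T' ks) (mutate_seq T ks).
Proof.
elim: ks T' T => [//|k ks IH] T' T rT eT; apply: IH; first exact: regular_mutate.
by apply: extends_mutate => // i; apply: regular_neq0.
Qed.

(** The nonvanishing hypothesis allows inverse variables to be specialized. *)
Lemma extends_laurent T' T f : extends T' T -> (forall i, svar T i != 0) ->
  in_laurent T' f -> exists2 g, in_laurent T g & specializes h f g.
Proof.
move=> [_ eo en] T0; elim=> [{}f [i _]||f1 f2 _ [g1 L1 s1] _ [g2 L2 s2]
                              |f1 f2 _ [g1 L1 s1] _ [g2 L2 s2]].
- elim/extended_indexP: i => [i|l] [->|->].
  + exists (svar T i); last exact: eo.
    by apply: subring_gen_in; exists i => //; left.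
  + exists (svar T i)^-1; last by apply: specializesV; [exact: eo | exact: T0].
    by apply: subring_gen_in; exists i => //; right.
  + by exists 1; [exact: subring_gen_1 | exact: en].
  + exists 1; first exact: subring_gen_1.
    rewrite -[X in specializes _ _ X]invr1.
    by apply: specializesV; [exact: en | exact: oner_neq0].
- by exists 1; [apply: subring_gen_1 | apply: specializes1].
- by exists (g1 - g2); [apply: subring_gen_B | apply: specializesB].
- by exists (g1 * g2); [apply: subring_gen_M | apply: specializesM].
Qed.

Lemma extends_xtilde T' T a : extends T' T -> sskew T' -> regular T ->
  specializes h (xtilde T' a) (xtilde T a).
Proof.
move=> eT skT' rT; case: (eT) => em eo en; have [_ skT _] := rT.
have T0 i : svar T i != 0 by apply: regular_neq0.
rewrite !xtilde_terms //; apply: specializesM.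
  apply: specializes_prod => l _; rewrite -old_index_mutable.
  by apply: specializesXz; [exact: eo | exact: T0].
have -> : s_gcc T' a = s_gcc T a.
  by apply/setP => s; rewrite !inE (extends_matrix_principal em).
apply: specializes_sum => s _; apply: specializes_prod => k _.
by apply: specializesM; apply: specializesX; apply: extends_monomial => // i; rewrite em.
Qed.

End Values.

Variable S : seed n p.

Definition extended_seed : seed n (p + n) :=
  Seed (generic_point _) (col_mx (usubmx (smat S)) (col_mx (dsubmx (smat S)) 1%:M)).

Definition extended_value (i : 'I_(n + (p + n))) : ratfun (n + p) :=
  match split i with
  | inl k => svar S (lshift p k)
  | inr j => match split j with inl f => svar S (rshift n f) | inr _ => 1 end
  end.

Definition evaluation : {mpoly rat[n + (p + n)]} -> ratfun (n + p) :=
  mmap (@FracField.tofrac _ \o @mpolyC (n + p) rat) extended_value.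

HB.instance Definition _ := GRing.RMorphism.copy evaluation
  (mmap (@FracField.tofrac _ \o @mpolyC (n + p) rat) extended_value).

Lemma evaluationX i : evaluation 'X_i = extended_value i.
Proof. by rewrite /evaluation mmapX mmap1U. Qed.

Lemma extended_extends_matrix : extends_matrix extended_seed S.
Proof.
move=> i j /=; case: (split_ordP i) => i' ->.
  by rewrite old_index_mutable col_mxEu mxE.
by rewrite old_index_frozen col_mxEd col_mxEu mxE.
Qed.

Lemma extended_extends : extends evaluation extended_seed S.
Proof.
split; first exact: extended_extends_matrix.
  move=> i; rewrite ffunE; have <- : evaluation 'X_(old_index i) = svar S i.
    rewrite evaluationX /extended_value; case: (split_ordP i) => i' ->.
      by rewrite old_index_mutable (unsplitK (inl i')).
    by rewrite old_index_frozen (unsplitK (inr _)) (unsplitK (inl i')).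
  exact: specializes_tofrac.
move=> l; rewrite ffunE; have <- : evaluation 'X_(new_index l) = 1.
  by rewrite evaluationX /extended_value (unsplitK (inr _)) (unsplitK (inr l)).
exact: specializes_tofrac.
Qed.

Lemma extended_full_rank : full_rank extended_seed.
Proof.
move=> c Bc j; have := Bc (new_index j); rewrite (bigD1 j) //= big1 ?addr0.
  by rewrite col_mxEd col_mxEd mxE eqxx mul1r.
by move=> l lj; rewrite col_mxEd col_mxEd mxE eq_sym (negbTE lj) mul0r.
Qed.

Lemma extended_regular : regular S -> regular extended_seed.
Proof.
case=> tS skS _; split; last exact: independent_generic.
  by move=> ks; apply: mutable_along_extends (tS ks); apply: extended_extends_matrix.
by rewrite /sskew (extends_matrix_principal extended_extends_matrix).
Qed.

End Extension.

(** * The seeds of a cluster algebra *)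

Section ClusterAlgebraSeeds.
Variables (n p : nat) (A : cluster_algebra n p).

Lemma initial_regular : regular (initial_seed A).
Proof.
have [[ind _] sk] := initial_seedP A.
by split=> //; apply: initial_seed_mutable.
Qed.

Lemma seed_of_regular S : seed_of A S -> regular S.
Proof. by move=> [ks [_ ->]]; apply/regular_mutate_seq/initial_regular. Qed.

(** Mutations are involutive, so the path from the initial seed to S can be run backwards. *)
Lemma seed_of_connected S T : seed_of A S -> seed_of A T -> exists ks, T = mutate_seq S ks.
Proof.
move=> [ks [_ ->]] [ls [_ ->]]; exists (rev ks ++ ls).
by rewrite mutate_seq_cat mutate_seq_rev //; apply: initial_regular.
Qed.

Lemma frozen_var (S : seed n p) ks j :
  svar (mutate_seq S ks) (rshift n j) = svar S (rshift n j).
Proof.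
elim: ks S => [//|k ks IH] S; rewrite [mutate_seq _ _]/= -/(mutate_seq _ _) IH.
by rewrite mutate_var_other // eq_rlshift.
Qed.

Lemma in_laurent_in_ring S f : seed_of A S -> in_laurent S f -> in_laurent_ring A S f.
Proof.
move=> [ks [_ ES]]; apply: gen_subset => g [i _ gi]; apply: subring_gen_in.
move: gi; case: (split_ordP i) => [k ->|j ->] gi; first by right; exists k.
left; apply: subring_gen_in; exists j => /=.
by rewrite -(frozen_var _ ks) -ES.
Qed.

End ClusterAlgebraSeeds.

Theorem theorem1p1 (n p : nat) (n_gt0 : (0 < n)%N)
    (A : cluster_algebra n p) (S : seed n p) (AS : seed_of A S)
    (a : 'I_n -> int) :
  in_upper_cluster_algebra A (xtilde S a).
Proof.
move=> T AT; apply: in_laurent_in_ring => //.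
have [ks ET] := seed_of_connected AS AT.
have rS := seed_of_regular AS; have rT := seed_of_regular AT.
have rS' := extended_regular rS; have eS := extended_extends S.
have L' := upper_bound_mutate_seq ks rS' (@extended_full_rank _ _ S)
  (xtilde_in_upper_bound rS' a).
have eT := extends_mutate_seq ks rS eS; rewrite -ET in eT.
have [g Lg sg] := extends_laurent eT (fun i => regular_neq0 i rT) L'.
have [_ skS' _] := rS'.
by rewrite (specializes_inj (extends_xtilde a eS skS' rS) sg).
Qed.
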